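(* Let $V(x,y)$ be a harmonic function defined on an open connected set $\mathcal{U}\subseteq\mathbb{R}^2$, and let $g_S$ be the semi-Riemannian metric of signature $(--++)$ on $\mathbb{R}^2\times\mathcal{U}=\{(v,t,x,y)\}$ given by $$g_S=2\,dv\,dt-2V(x,y)(dt)^2-(dx)^2+(dy)^2 .$$ Set $F=V_x+i(-V_y)$, regarded as a function of $z=x+iy$. Fix $t_0\in\mathbb{R}$. (1) There is a bijection between maximal solutions $z(t)=x(t)+iy(t)$ of the complex ODE $\ddot{z}=F(z(t))$, with initial data $z(t_0)=z_0=x_0+iy_0$, $\dot z(t_0)=\dot z_0=\dot x_0+i\dot y_0$, and maximal lightlike geodesics $\gamma(t)=(v(t),t,x(t),y(t))$ of $g_S$ with initial data $$\gamma(t_0)=(0,t_0,x_0,y_0),\qquad \gamma'(t_0)=\Big(-\tfrac12\big(-\dot x_0^2+\dot y_0^2\big)+V(x_0,y_0),\,1,\,\dot x_0,\,\dot y_0\Big),$$ where $z(t)$ corresponds to the geodesic with the same components $x(t),y(t)$. (2) For any $C^2$ function $f$ on $\mathcal{U}$ (viewed as a function on $\mathbb{R}^2\times\mathcal{U}$), each solution $z(t)$ is, via its lightlike geodesic $\gamma(t)$ and after a reparametrization, also a solution of the geodesic equations of motion of the conformal metric $e^{2f}g_S$: namely, the curve $\gamma_f(s)=\gamma(\tau^{-1}(s))$, where $s=\tau(t)=\int_{t_0}^te^{2f(\gamma(r))}\,dr$, is a lightlike geodesic of $e^{2f}g_S$. (3) This also includes all conjugate points and their multiplicities: two points $\gamma(a),\gamma(a')$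 are conjugate along $\gamma$ with respect to $g_S$ if and only if the points $\gamma_f(\tau(a)),\gamma_f(\tau(a'))$ are conjugate along $\gamma_f$ with respect to $e^{2f}g_S$, with the same multiplicity.
   Context: A tangent vector $X$ of a semi-Riemannian manifold $(M,g)$ is lightlike if $X\ne0$ and $g(X,X)=0$; a geodesic is lightlike if its velocity is. A Jacobi field along a geodesic $\gamma$ is a $C^2$ vector field $J(t)$ along $\gamma$ with $J''+R_g(J,\gamma')\gamma'=0$, where $R_g$ is the curvature endomorphism and primes on $J$ denote covariant derivatives along $\gamma$. Points $\gamma(a),\gamma(a')$ with $a<a'$ are conjugate along $\gamma$ if there is a nontrivial Jacobi field $J$ along $\gamma$ with $J(a)=J(a')=0$; the multiplicity is the dimension of the space of Jacobi fields along $\gamma$ vanishing at both $a$ and $a'$. *)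

(* Defs.v *)
(* Stdlib reals with Coquelicot. *)
From Stdlib Require Import Reals.
From Coquelicot Require Import Coquelicot.
Open Scope R_scope.

Definition connected {T : UniformSpace} (U : T -> Prop) : Prop :=
  forall A B : T -> Prop,
    open A -> open B ->
    (forall p, U p -> A p \/ B p) ->
    (forall p, U p -> A p -> B p -> False) ->
    (exists p, U p /\ A p) -> (exists p, U p /\ B p) -> False.

Definition dx (V : R -> R -> R) (x y : R) : R := Derive (fun u => V u y) x.
Definition dy (V : R -> R -> R) (x y : R) : R := Derive (fun u => V x u) y.

Definition C1_plane (U : R * R -> Prop) (V : R -> R -> R) : Prop :=
  forall x y, U (x, y) ->
    ex_derive (fun u => V u y) x /\ ex_derive (fun u => V x u) y /\
    continuity_2d_pt (dx V) x y /\ continuity_2d_pt (dy V) x y.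

Definition C2_plane (U : R * R -> Prop) (V : R -> R -> R) : Prop :=
  C1_plane U V /\ C1_plane U (dx V) /\ C1_plane U (dy V).

Definition harmonic (U : R * R -> Prop) (V : R -> R -> R) : Prop :=
  C2_plane U V /\
  forall x y, U (x, y) -> dx (dx V) x y + dy (dy V) x y = 0.

(* Only the values of [pt] on [dom] are meaningful, so that curves are
   compared with [curve_eq]. *)
Record curve (X : Type) := Curve { dom : R -> Prop; pt : R -> X }.
Arguments Curve {X}.
Arguments dom {X}.
Arguments pt {X}.

Definition open_interval (I : R -> Prop) : Prop :=
  (exists t, I t) /\ open I /\
  forall a b c, I a -> I b -> a <= c <= b -> I c.

Definition extends {X} (c d : curve X) : Prop :=
  forall t, dom c t -> dom d t /\ pt d t = pt c t.

Definition curve_eq {X} (c d : curve X) : Prop :=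
  extends c d /\ extends d c.

Definition maximal {X} (P : curve X -> Prop) (c : curve X) : Prop :=
  P c /\ forall d, P d -> extends c d -> forall t, dom d t -> dom c t.

Definition bijection {X Y} (P : curve X -> Prop) (Q : curve Y -> Prop)
    (Phi : curve X -> curve Y) : Prop :=
  (forall c, P c -> Q (Phi c)) /\
  (forall c d, P c -> P d -> (curve_eq (Phi c) (Phi d) <-> curve_eq c d)) /\
  (forall e, Q e -> exists c, P c /\ curve_eq (Phi c) e).

Inductive coord := cv | ct | cx | cy.

Definition coord_eq_dec (i j : coord) : {i = j} + {i <> j}.
Proof. decide equality. Defined.

(* Points of R^4, and also tangent vectors, given by their components in the
   coordinate frame. *)
Definition vec := coord -> R.

Definition vec4 (a b c d : R) : vec :=
  fun i => match i with cv => a | ct => b | cx => c | cy => d end.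

Definition sum4 (F : coord -> R) : R := F cv + F ct + F cx + F cy.

Definition update (p : vec) (i : coord) (s : R) : vec :=
  fun j => if coord_eq_dec j i then s else p j.

Definition pd (i : coord) (phi : vec -> R) (p : vec) : R :=
  Derive (fun s => phi (update p i s)) (p i).

(* [upper] is the inverse matrix g^{ij} of [lower], the matrix g_{ij};
   its existence is the nondegeneracy of the metric. *)
Record metric := Metric {
  region : vec -> Prop;
  lower : vec -> coord -> coord -> R;
  upper : vec -> coord -> coord -> R;
  lower_sym : forall p i j, region p -> lower p i j = lower p j i;
  lower_upper : forall p i j, region p ->
    sum4 (fun k => lower p i k * upper p k j) =
      if coord_eq_dec i j then 1 else 0
}.

Definition inner (g : metric) (p X Y : vec) : R :=
  sum4 (fun i => sum4 (fun j => lower g p i j * X i * Y j)).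

Definition lightlike (g : metric) (p X : vec) : Prop :=
  (exists i, X i <> 0) /\ inner g p X X = 0.

(* Gamma^k_{ij} of the Levi-Civita connection *)
Definition Gamma (g : metric) (k i j : coord) (p : vec) : R :=
  / 2 * sum4 (fun l => upper g p k l *
    (pd i (fun q => lower g q j l) p + pd j (fun q => lower g q i l) p
     - pd l (fun q => lower g q i j) p)).

(* Component l of R(e_i, e_j) e_k in the coordinate frame (e_i), for
   R(X,Y)Z = D_X D_Y Z - D_Y D_X Z - D_[X,Y] Z; this is the sign for which the
   Jacobi equation is J'' + R(J,c')c' = 0. *)
Definition Riem (g : metric) (l k i j : coord) (p : vec) : R :=
  pd i (Gamma g l j k) p - pd j (Gamma g l i k) p +
  sum4 (fun m => Gamma g l i m p * Gamma g m j k p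
                 - Gamma g l j m p * Gamma g m i k p).

Definition curvature (g : metric) (p X Y Z : vec) : vec := fun l =>
  sum4 (fun k => sum4 (fun i => sum4 (fun j =>
    Riem g l k i j p * X i * Y j * Z k))).

Definition C2_on (I : R -> Prop) (u : R -> R) : Prop :=
  forall t, I t ->
    ex_derive u t /\ ex_derive (Derive u) t /\
    continuous (Derive (Derive u)) t.

Definition velocity (c : R -> vec) : R -> vec :=
  fun t k => Derive (fun s => c s k) t.

Definition covD (g : metric) (c X : R -> vec) : R -> vec := fun t k =>
  Derive (fun s => X s k) t +
  sum4 (fun i => sum4 (fun j =>
    Gamma g k i j (c t) * velocity c t i * X t j)).

Definition geodesic (g : metric) (c : curve vec) : Prop :=
  open_interval (dom c) /\
  (forall k, C2_on (dom c) (fun t => pt c t k)) /\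
  forall t, dom c t ->
    region g (pt c t) /\
    forall k, covD g (pt c) (velocity (pt c)) t k = 0.

Definition lightlike_geodesic (g : metric) (c : curve vec) : Prop :=
  geodesic g c /\
  forall t, dom c t -> lightlike g (pt c t) (velocity (pt c) t).

Definition jacobi (g : metric) (c : curve vec) (J : R -> vec) : Prop :=
  (forall k, C2_on (dom c) (fun t => J t k)) /\
  forall t, dom c t -> forall k,
    covD g (pt c) (covD g (pt c) J) t k +
    curvature g (pt c t) (J t) (velocity (pt c) t) (velocity (pt c) t) k
    = 0.

Definition jacobi_vanishing (g : metric) (c : curve vec) (a a' : R)
    (J : R -> vec) : Prop :=
  jacobi g c J /\ (forall k, J a k = 0) /\ (forall k, J a' k = 0).

Definition conjugate (g : metric) (c : curve vec) (a a' : R) : Prop :=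
  dom c a /\ dom c a' /\ a < a' /\
  exists J, jacobi_vanishing g c a a' J /\
    exists t k, dom c t /\ J t k <> 0.

(* The Jacobi fields vanishing at a and a' have a basis B 1, ..., B n;
   fields are identified when they agree on [dom c]. *)
Definition multiplicity (g : metric) (c : curve vec) (a a' : R) (n : nat)
    : Prop :=
  exists B : nat -> R -> vec,
    (forall i, (1 <= i <= n)%nat -> jacobi_vanishing g c a a' (B i)) /\
    (forall r : nat -> R,
       (forall t k, dom c t -> sum_n_m (fun i => r i * B i t k) 1 n = 0) ->
       forall i, (1 <= i <= n)%nat -> r i = 0) /\
    (forall J, jacobi_vanishing g c a a' J ->
       exists r : nat -> R, forall t k, dom c t ->
         J t k = sum_n_m (fun i => r i * B i t k) 1 n).

Definition gS_lower (V : R -> R -> R) (p : vec) (i j : coord) : R :=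
  match i, j with
  | cv, ct | ct, cv => 1
  | ct, ct => - 2 * V (p cx) (p cy)
  | cx, cx => - 1
  | cy, cy => 1
  | _, _ => 0
  end.

Definition gS_upper (V : R -> R -> R) (p : vec) (i j : coord) : R :=
  match i, j with
  | cv, ct | ct, cv => 1
  | cv, cv => 2 * V (p cx) (p cy)
  | cx, cx => - 1
  | cy, cy => 1
  | _, _ => 0
  end.

Definition gS (U : R * R -> Prop) (V : R -> R -> R) : metric.
Proof.
refine {| region := fun p => U (p cx, p cy);
          lower := gS_lower V; upper := gS_upper V |}.
- intros p i j _; destruct i, j; reflexivity.
- intros p i j _; unfold sum4; destruct i, j; simpl; ring.
Defined.

Lemma gS_quadratic U V p X :
  inner (gS U V) p X X =
    2 * X cv * X ct - 2 * V (p cx) (p cy) * (X ct) ^ 2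
    - (X cx) ^ 2 + (X cy) ^ 2.
Proof. unfold inner, sum4; simpl; ring. Qed.

Definition on_R4 (f : R -> R -> R) (p : vec) : R := f (p cx) (p cy).

Definition conformal (f : vec -> R) (g : metric) : metric.
Proof.
refine {| region := region g;
          lower := fun p i j => exp (2 * f p) * lower g p i j;
          upper := fun p i j => / exp (2 * f p) * upper g p i j |}.
- intros p i j hp; rewrite (lower_sym g p i j hp); reflexivity.
- intros p i j hp; rewrite <- (lower_upper g p i j hp); unfold sum4.
  field; apply Rgt_not_eq, exp_pos.
Defined.

(* The new parameter s of the reparametrized curve, as a function of t *)
Definition conf_time (f : vec -> R) (c : R -> vec) (t0 t : R) : R :=
  RInt (fun r => exp (2 * f (c r))) t0 t.

Definition F (V : R -> R -> R) (z : C) : C :=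
  (RtoC (dx V (Re z) (Im z)) + Ci * RtoC (- dy V (Re z) (Im z)))%C.

Definition solution (U : R * R -> Prop) (V : R -> R -> R) (z : curve C)
    : Prop :=
  open_interval (dom z) /\
  exists w : R -> C, forall t, dom z t ->
    U (pt z t) /\
    is_derive (V := C_R_NormedModule) (pt z) t (w t) /\
    is_derive (V := C_R_NormedModule) w t (F V (pt z t)).

Definition initial_z (t0 : R) (z0 dz0 : C) (z : curve C) : Prop :=
  dom z t0 /\ pt z t0 = z0 /\
  is_derive (V := C_R_NormedModule) (pt z) t0 dz0.

Definition initial_geodesic (V : R -> R -> R) (t0 : R) (z0 dz0 : C)
    (c : curve vec) : Prop :=
  dom c t0 /\
  (forall k, pt c t0 k = vec4 0 t0 (Re z0) (Im z0) k) /\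
  (forall k, velocity (pt c) t0 k =
     vec4 (- / 2 * (- (Re dz0) ^ 2 + (Im dz0) ^ 2) + V (Re z0) (Im z0))
          1 (Re dz0) (Im dz0) k).

(* c has the form (v(t), t, x(t), y(t)) with z(t) = x(t) + i y(t). *)
Definition same_components (z : curve C) (c : curve vec) : Prop :=
  (forall t, dom z t <-> dom c t) /\
  forall t, dom c t ->
    pt c t ct = t /\ pt c t cx = Re (pt z t) /\ pt c t cy = Im (pt z t).

(* Main.v *)
From Stdlib Require Import Reals Lra Lia Classical ClassicalEpsilon
  FunctionalExtensionality Ranalysis5.
From Coquelicot Require Import Coquelicot.
Require Import Defs.
Open Scope R_scope.

(** The nonzero Christoffel symbols of [gS] are, up to sign, the first
    derivatives of [V]. They give
    [t'' = 0], [x'' = V_x t'^2], [y'' = - V_y t'^2] for a geodesic, and one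
    equation for [v]. With the given initial data [t] is the parameter, the
    equations for [x] and [y] are [z'' = F z], and the null condition reads
    [v' = V + (x'^2 - y'^2) / 2], from which [v] is recovered by integration
    ([lift]). The equation for [v''] is the derivative of this one. Maximality
    passes between [z] and its geodesic because every extension of the one
    projects or lifts to an extension of the other
    ([null_geodesics_bijection]).

    The conformal change adds [2 W' c' - g(c',c') grad f] to the geodesic
    equation, where [W = f o c]. For a null curve the second term vanishes,
    and the change of parameter [ds = exp (2 W) dt] absorbs the first
    ([reparam_null_geodesic]).

    For the Jacobi fields, the Jacobi equation along a geodesic is the
    linearised geodesic equation ([jacobi_equation_linearised]). Let [L] be the
    Jacobi operator of [gS] along [c]. A field along the reparametrised
    geodesic, read as a field [K] in the parameter [t], is a Jacobi field of
    the conformal metric if and only if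
    [L K + 2 (df K)' c' - 2 g(c',K)' grad f = 0] ([conformal_jacobi_iff]).
    The product of [c'] with a Jacobi field that vanishes at two points is
    zero, for [gS] because its second derivative is [g(c', L J) = 0], for the
    conformal metric because its first derivative is a constant times
    [exp (2 W)]. So the last term drops out, and the middle one is tangential.
    As [L (phi c') = phi'' c'], a Jacobi field for one metric becomes one for
    the other by adding [phi c'], where [phi] solves a linear second-order
    equation that is integrated explicitly with zeros at both given points
    ([gS_field_to_conformal], [conformal_field_to_gS]). A tangential Jacobi
    field with two zeros vanishes, for either metric. Hence being equal modulo
    [c'] is a linear isomorphism between the two spaces of Jacobi fields
    vanishing at the two points ([jacobi_correspondence]), which gives the
    conjugate points and their multiplicities. *)

(** * Calculus on an open interval *)

Lemma is_derive_plus_R (u w : R -> R) (t : R) (u' w' : R) :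
  is_derive u t u' -> is_derive w t w' ->
  is_derive (fun t => u t + w t) t (u' + w').
Proof. exact (is_derive_plus u w t u' w'). Qed.

Lemma is_derive_mult_R (u w : R -> R) (t : R) (u' w' : R) :
  is_derive u t u' -> is_derive w t w' ->
  is_derive (fun t => u t * w t) t (u' * w t + u t * w').
Proof.
  intros Hu Hw; exact (is_derive_mult u w t u' w' Hu Hw Rmult_comm).
Qed.

Lemma is_derive_minus_R (u w : R -> R) t (u' w' : R) :
  is_derive u t u' -> is_derive w t w' ->
  is_derive (fun t => u t - w t) t (u' - w').
Proof. exact (is_derive_minus u w t u' w'). Qed.

Lemma is_derive_scal_R (a : R) (u : R -> R) t (u' : R) :
  is_derive u t u' -> is_derive (fun t => a * u t) t (a * u').
Proof. exact (is_derive_scal u t a u'). Qed.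

Lemma continuous_plus_R (u w : R -> R) (t : R) :
  continuous u t -> continuous w t -> continuous (fun t => u t + w t) t.
Proof. exact (continuous_plus u w t). Qed.

Lemma continuous_mult_R (u w : R -> R) (t : R) :
  continuous u t -> continuous w t -> continuous (fun t => u t * w t) t.
Proof. exact (continuous_mult u w t). Qed.

Lemma is_derive_continuous (u : R -> R) (t l : R) :
  is_derive u t l -> continuous u t.
Proof. intro H; apply (ex_derive_continuous u); exists l; exact H. Qed.

Lemma is_derive_comp_R (u p : R -> R) (t : R) (u' p' : R) :
  is_derive u (p t) u' -> is_derive p t p' ->
  is_derive (fun s => u (p s)) t (u' * p').
Proof.
  intros Hu Hp; rewrite Rmult_comm; exact (is_derive_comp u p t u' p' Hu Hp).
Qed.

Lemma open_interval_locally (I : R -> Prop) (t : R) :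
  open_interval I -> I t -> locally t I.
Proof. intros (_ & Io & _) It; exact (Io t It). Qed.

Lemma open_interval_between (I : R -> Prop) (a b t : R) :
  open_interval I -> I a -> I b -> Rmin a b <= t <= Rmax a b -> I t.
Proof.
  intros (_ & _ & Ic) Ia Ib Ht; unfold Rmin, Rmax in Ht.
  destruct (Rle_dec a b).
  - exact (Ic a b t Ia Ib Ht).
  - exact (Ic b a t Ib Ia Ht).
Qed.

Lemma MVT_interval (I : R -> Prop) (u u' : R -> R) (a b : R) :
  open_interval I -> I a -> I b ->
  (forall t, I t -> is_derive u t (u' t)) ->
  exists xi, I xi /\ u b - u a = u' xi * (b - a).
Proof.
  intros HI Ia Ib Hu.
  assert (H : forall t, Rmin a b <= t <= Rmax a b -> I t)
    by (intros t Ht; exact (open_interval_between I a b t HI Ia Ib Ht)).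
  destruct (MVT_gen u a b u') as (xi & Hxi & E).
  - intros t Ht; apply Hu, H; lra.
  - intros t Ht; apply continuity_pt_filterlim.
    exact (is_derive_continuous u t (u' t) (Hu t (H t Ht))).
  - exists xi; split; [apply H, Hxi | exact E].
Qed.

Lemma derive_zero_const (I : R -> Prop) (u : R -> R) (a b : R) :
  open_interval I -> (forall t, I t -> is_derive u t 0) ->
  I a -> I b -> u a = u b.
Proof.
  intros HI Hu Ia Ib.
  destruct (MVT_interval I u (fun _ => 0) a b HI Ia Ib Hu)
    as (xi & _ & E); lra.
Qed.

Lemma same_derivative_eq (I : R -> Prop) (u w d : R -> R) (a t : R) :
  open_interval I ->
  (forall t, I t -> is_derive u t (d t)) ->
  (forall t, I t -> is_derive w t (d t)) ->
  I a -> u a = w a -> I t -> u t = w t.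
Proof.
  intros HI Hu Hw Ia Ea It.
  enough (u t - w t = u a - w a) by lra.
  apply (derive_zero_const I (fun t => u t - w t) t a HI); try assumption.
  intros s Is; replace 0 with (minus (d s) (d s))
    by (unfold minus, plus, opp; simpl; ring).
  apply (is_derive_minus u w); [apply Hu | apply Hw]; exact Is.
Qed.

(** By Rolle the constant [C] vanishes, since [m] does not. *)
Lemma two_zeros_vanish (I : R -> Prop) (u m : R -> R) (C a a' t : R) :
  open_interval I -> I a -> I a' -> a < a' ->
  (forall t, I t -> 0 < m t) ->
  (forall t, I t -> is_derive u t (C * m t)) ->
  u a = 0 -> u a' = 0 -> I t -> u t = 0.
Proof.
  intros HI Ia Ia' Haa Hm Hu Ea Ea' It.
  destruct (MVT_interval I u _ a a' HI Ia Ia' Hu) as (xi & Ixi & E).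
  assert (C0 : C = 0).
  { rewrite Ea, Ea' in E.
    assert (Hp := Rmult_lt_0_compat _ _ (Hm xi Ixi)
      (proj2 (Rlt_0_minus _ _) Haa)).
    assert (E' : C * (m xi * (a' - a)) = 0) by (rewrite <- Rmult_assoc; lra).
    apply Rmult_integral in E'; destruct E'; [assumption | lra]. }
  rewrite <- Ea.
  apply (derive_zero_const I); try assumption.
  intros s Is; rewrite <- (Rmult_0_l (m s)), <- C0; exact (Hu s Is).
Qed.

Lemma two_zeros_affine (I : R -> Prop) (u u1 : R -> R) (a a' t : R) :
  open_interval I -> I a -> I a' -> a < a' ->
  (forall t, I t -> is_derive u t (u1 t)) ->
  (forall t, I t -> is_derive u1 t 0) ->
  u a = 0 -> u a' = 0 -> I t -> u t = 0.
Proof.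
  intros HI Ia Ia' Haa Hu Hu1 Ea Ea' It.
  apply (two_zeros_vanish I u (fun _ => 1) (u1 a) a a'); try assumption.
  - intros; lra.
  - intros s Is; rewrite Rmult_1_r, (derive_zero_const I u1 a s); auto.
Qed.

Lemma is_derive_RInt_interval (I : R -> Prop) (k : R -> R) (a t : R) :
  open_interval I -> (forall t, I t -> continuous k t) ->
  I a -> I t -> is_derive (fun t => RInt k a t) t (k t).
Proof.
  intros HI Hk Ia It.
  apply (is_derive_RInt k _ a t).
  - apply filter_imp with I; [ | exact (open_interval_locally I t HI It)].
    intros s Is; apply (@RInt_correct R_CompleteNormedModule).
    apply (@ex_RInt_continuous R_CompleteNormedModule).
    intros r Hr; apply Hk, (open_interval_between I a s r); assumption.
  - exact (Hk t It).
Qed.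

(** The free constant [C] absorbs the second boundary condition. *)
Lemma two_point_primitive (I : R -> Prop) (k m : R -> R) (a a' : R) :
  open_interval I -> I a -> I a' -> a < a' ->
  (forall t, I t -> continuous k t) ->
  (forall t, I t -> continuous m t) -> (forall t, I t -> 0 < m t) ->
  exists (C : R) (u : R -> R),
    (forall t, I t -> is_derive u t (k t + C * m t)) /\ u a = 0 /\ u a' = 0.
Proof.
  intros HI Ia Ia' Haa Hk Hm Hm0.
  pose (K := fun t => RInt k a t); pose (M := fun t => RInt m a t).
  assert (dK := fun t => is_derive_RInt_interval I k a t HI Hk Ia).
  assert (dM := fun t => is_derive_RInt_interval I m a t HI Hm Ia).
  fold K in dK; fold M in dM.
  assert (K0 : K a = 0) by exact (RInt_point a k).
  assert (M0 : M a = 0) by exact (RInt_point a m).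
  assert (M1 : M a' <> 0).
  { destruct (MVT_interval I M m a a' HI Ia Ia' dM) as (xi & Ixi & E).
    assert (Hp := Rmult_lt_0_compat _ _ (Hm0 xi Ixi)
      (proj2 (Rlt_0_minus _ _) Haa)).
    lra. }
  exists (- K a' / M a'), (fun t => K t + - K a' / M a' * M t).
  split; [ | split].
  - intros t It; apply (is_derive_plus K); [exact (dK t It) | ].
    exact (is_derive_scal M t (- K a' / M a') _ (dM t It)).
  - rewrite K0, M0; ring.
  - field; exact M1.
Qed.

Lemma C2_on_derive (I : R -> Prop) (u : R -> R) (t : R) :
  C2_on I u -> I t -> is_derive u t (Derive u t).
Proof. intros H It; apply Derive_correct, (H t It). Qed.

Lemma C2_on_derive2 (I : R -> Prop) (u : R -> R) (t : R) :
  C2_on I u -> I t -> is_derive (Derive u) t (Derive (Derive u) t).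
Proof. intros H It; apply Derive_correct, (H t It). Qed.

Lemma Derive_on (I : R -> Prop) (u u1 : R -> R) (t : R) :
  open_interval I -> (forall t, I t -> is_derive u t (u1 t)) ->
  I t -> locally t (fun s => Derive u s = u1 s).
Proof.
  intros HI Hu It.
  apply filter_imp with I; [ | exact (open_interval_locally I t HI It)].
  intros s Is; apply is_derive_unique, Hu, Is.
Qed.

Lemma Derive2_on (I : R -> Prop) (u u1 u2 : R -> R) (t : R) :
  open_interval I ->
  (forall t, I t -> is_derive u t (u1 t)) ->
  (forall t, I t -> is_derive u1 t (u2 t)) ->
  I t -> is_derive (Derive u) t (u2 t).
Proof.
  intros HI Hu Hu1 It.
  apply is_derive_ext_loc with u1; [ | exact (Hu1 t It)].
  apply filter_imp with (2 := Derive_on I u u1 t HI Hu It); auto.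
Qed.

Lemma C2_on_intro (I : R -> Prop) (u u1 u2 : R -> R) :
  open_interval I ->
  (forall t, I t -> is_derive u t (u1 t)) ->
  (forall t, I t -> is_derive u1 t (u2 t)) ->
  (forall t, I t -> continuous u2 t) -> C2_on I u.
Proof.
  intros HI Hu Hu1 Hu2 t It; split; [ | split].
  - exists (u1 t); exact (Hu t It).
  - exists (u2 t); exact (Derive2_on I u u1 u2 t HI Hu Hu1 It).
  - apply continuous_ext_loc with u2; [ | exact (Hu2 t It)].
    apply filter_imp with I; [ | exact (open_interval_locally I t HI It)].
    intros s Is; symmetry; apply is_derive_unique.
    exact (Derive2_on I u u1 u2 s HI Hu Hu1 Is).
Qed.

Lemma C2_on_ext (I : R -> Prop) (u w : R -> R) :
  open_interval I -> (forall t, I t -> u t = w t) -> C2_on I u -> C2_on I w.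
Proof.
  intros HI E Hu.
  apply C2_on_intro with (Derive u) (Derive (Derive u)); [exact HI | | |].
  - intros t It; apply is_derive_ext_loc with u.
    + apply filter_imp with I; [exact E | ].
      exact (open_interval_locally I t HI It).
    + exact (C2_on_derive I u t Hu It).
  - intros t It; exact (C2_on_derive2 I u t Hu It).
  - intros t It; exact (proj2 (proj2 (Hu t It))).
Qed.

Lemma C2_on_continuous (I : R -> Prop) (u : R -> R) (t : R) :
  C2_on I u -> I t -> continuous u t.
Proof.
  intros H It; exact (is_derive_continuous u t _ (C2_on_derive I u t H It)).
Qed.

Lemma C2_on_continuous1 (I : R -> Prop) (u : R -> R) (t : R) :
  C2_on I u -> I t -> continuous (Derive u) t.
Proof.
  intros H It.
  exact (is_derive_continuous (Derive u) t _ (C2_on_derive2 I u t H It)).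
Qed.

Lemma C2_on_continuous2 (I : R -> Prop) (u : R -> R) (t : R) :
  C2_on I u -> I t -> continuous (Derive (Derive u)) t.
Proof. intros H It; apply (H t It). Qed.

Lemma C2_on_plus (I : R -> Prop) (u w : R -> R) :
  open_interval I -> C2_on I u -> C2_on I w -> C2_on I (fun t => u t + w t).
Proof.
  intros HI Hu Hw.
  apply (C2_on_intro I _ (fun t => Derive u t + Derive w t)
    (fun t => Derive (Derive u) t + Derive (Derive w) t) HI); intros t It.
  - apply is_derive_plus_R; apply (C2_on_derive I); assumption.
  - apply is_derive_plus_R; apply (C2_on_derive2 I); assumption.
  - apply continuous_plus_R; apply (C2_on_continuous2 I); assumption.
Qed.

Lemma C2_on_mult (I : R -> Prop) (u w : R -> R) :
  open_interval I -> C2_on I u -> C2_on I w -> C2_on I (fun t => u t * w t).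
Proof.
  intros HI Hu Hw.
  apply (C2_on_intro I _ (fun t => Derive u t * w t + u t * Derive w t)
    (fun t => (Derive (Derive u) t * w t + Derive u t * Derive w t)
      + (Derive u t * Derive w t + u t * Derive (Derive w) t)) HI);
    intros t It.
  - apply is_derive_mult_R; apply (C2_on_derive I); assumption.
  - apply is_derive_plus_R; apply is_derive_mult_R;
      (now apply (C2_on_derive I)) || now apply (C2_on_derive2 I).
  - assert (cu := C2_on_continuous I u t Hu It).
    assert (cw := C2_on_continuous I w t Hw It).
    assert (cu1 := C2_on_continuous1 I u t Hu It).
    assert (cw1 := C2_on_continuous1 I w t Hw It).
    assert (cu2 := C2_on_continuous2 I u t Hu It).
    assert (cw2 := C2_on_continuous2 I w t Hw It).
    apply continuous_plus_R; apply continuous_plus_R.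
    + exact (continuous_mult_R _ _ _ cu2 cw).
    + exact (continuous_mult_R _ _ _ cu1 cw1).
    + exact (continuous_mult_R _ _ _ cu1 cw1).
    + exact (continuous_mult_R _ _ _ cu cw2).
Qed.

Lemma C2_on_const (I : R -> Prop) (C : R) :
  open_interval I -> C2_on I (fun _ => C).
Proof.
  intro HI; apply C2_on_intro with (fun _ => 0) (fun _ => 0); [exact HI | | |].
  - intros t _; apply (is_derive_const C).
  - intros t _; apply (is_derive_const 0).
  - intros t _; apply continuous_const.
Qed.

Lemma comp_derive2 (I E : R -> Prop) (u : R -> R) (u1 u2 : R -> R)
    (p : R -> R) (p1 p2 : R -> R) :
  (forall t, E t -> I (p t)) ->
  (forall t, I t -> is_derive u t (u1 t)) ->
  (forall t, I t -> is_derive u1 t (u2 t)) ->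
  (forall t, E t -> is_derive p t (p1 t)) ->
  (forall t, E t -> is_derive p1 t (p2 t)) ->
  forall t, E t ->
    is_derive (fun t => u (p t)) t (u1 (p t) * p1 t) /\
    is_derive (fun t => u1 (p t) * p1 t) t
      (u2 (p t) * p1 t * p1 t + u1 (p t) * p2 t).
Proof.
  intros Hmap Hu Hu1 Hp Hp1 t Et; split.
  - apply is_derive_comp_R; auto.
  - apply (is_derive_mult_R (fun t => u1 (p t)));
      [apply is_derive_comp_R | ]; auto.
Qed.

Lemma C2_on_comp (I E : R -> Prop) (u p : R -> R) :
  open_interval E -> (forall t, E t -> I (p t)) ->
  C2_on I u -> C2_on E p -> C2_on E (fun t => u (p t)).
Proof.
  intros HE Hmap Hu Hp.
  assert (D := comp_derive2 I E u (Derive u) (Derive (Derive u))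
    p (Derive p) (Derive (Derive p)) Hmap
    (fun t => C2_on_derive I u t Hu) (fun t => C2_on_derive2 I u t Hu)
    (fun t => C2_on_derive E p t Hp) (fun t => C2_on_derive2 E p t Hp)).
  apply (C2_on_intro E _ _ _ HE (fun t Et => proj1 (D t Et))
    (fun t Et => proj2 (D t Et))).
  intros t Et.
  assert (cp := C2_on_continuous E p t Hp Et).
  assert (cp1 := C2_on_continuous1 E p t Hp Et).
  assert (cu1 := continuous_comp p _ t cp
    (C2_on_continuous1 I u (p t) Hu (Hmap t Et))).
  assert (cu2 := continuous_comp p _ t cp
    (C2_on_continuous2 I u (p t) Hu (Hmap t Et))).
  exact (continuous_plus_R _ _ t
    (continuous_mult_R _ _ t (continuous_mult_R _ _ t cu2 cp1) cp1)
    (continuous_mult_R _ _ t cu1 (C2_on_continuous2 E p t Hp Et))).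
Qed.

(** * Functions on the plane *)

Lemma open_plane_locally (U : R * R -> Prop) (x y : R) :
  open U -> U (x, y) -> locally_2d (fun u v => U (u, v)) x y.
Proof.
  intros HU Uxy; apply locally_2d_locally.
  apply filter_imp with U; [ | exact (HU _ Uxy)].
  intros [u v] Huv; exact Huv.
Qed.

Lemma open_plane_slice (U : R * R -> Prop) (x y : R) :
  open U -> U (x, y) ->
  locally x (fun u => U (u, y)) /\ locally y (fun v => U (x, v)).
Proof.
  intros HU Uxy; destruct (HU _ Uxy) as [e He].
  split; exists e; intros z Hz; apply He; split; simpl;
    solve [exact Hz | apply ball_center].
Qed.

Lemma C1_plane_intro (U : R * R -> Prop) (h hx hy : R -> R -> R) :
  open U ->
  (forall x y, U (x, y) -> is_derive (fun u => h u y) x (hx x y)) ->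
  (forall x y, U (x, y) -> is_derive (fun v => h x v) y (hy x y)) ->
  (forall x y, U (x, y) -> continuity_2d_pt hx x y) ->
  (forall x y, U (x, y) -> continuity_2d_pt hy x y) -> C1_plane U h.
Proof.
  intros HU Hx Hy cx cy x y Uxy; split; [ | split; [ | split]].
  - exists (hx x y); exact (Hx x y Uxy).
  - exists (hy x y); exact (Hy x y Uxy).
  - apply continuity_2d_pt_ext_loc with hx; [ | exact (cx x y Uxy)].
    destruct (open_plane_locally U x y HU Uxy) as [e He].
    exists e; intros u v Hu Hv; symmetry.
    apply is_derive_unique, Hx, He; assumption.
  - apply continuity_2d_pt_ext_loc with hy; [ | exact (cy x y Uxy)].
    destruct (open_plane_locally U x y HU Uxy) as [e He].
    exists e; intros u v Hu Hv; symmetry.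
    apply is_derive_unique, Hy, He; assumption.
Qed.

Lemma C1_plane_filterdiff (U : R * R -> Prop) (h : R -> R -> R) (x y : R) :
  open U -> C1_plane U h -> U (x, y) ->
  filterdiff (fun u : R * R => h (fst u) (snd u)) (locally (x, y))
    (fun u => plus (scal (fst u) (dx h x y)) (scal (snd u) (dy h x y))).
Proof.
  intros HU Hh Uxy; destruct (Hh x y Uxy) as (_ & ey & cx & _).
  apply (is_derive_filterdiff h x y (dx h)).
  - apply filter_imp with U; [ | exact (HU _ Uxy)].
    intros [u v] Huv; apply Derive_correct, (Hh u v Huv).
  - apply Derive_correct, ey.
  - apply continuity_2d_pt_filterlim, cx.
Qed.

Lemma C1_plane_continuity (U : R * R -> Prop) (h : R -> R -> R) (x y : R) :
  open U -> C1_plane U h -> U (x, y) -> continuity_2d_pt h x y.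
Proof.
  intros HU Hh Uxy; apply continuity_2d_pt_filterlim.
  apply (filterdiff_continuous (fun u : R * R => h (fst u) (snd u))).
  eexists; exact (C1_plane_filterdiff U h x y HU Hh Uxy).
Qed.

Lemma is_derive_comp_plane (U : R * R -> Prop) (h : R -> R -> R)
    (p q : R -> R) t (p' q' : R) :
  open U -> C1_plane U h -> U (p t, q t) ->
  is_derive p t p' -> is_derive q t q' ->
  is_derive (fun s => h (p s) (q s)) t
    (dx h (p t) (q t) * p' + dy h (p t) (q t) * q').
Proof.
  intros HU Hh Upq Hp Hq.
  apply filterdiff_ext_lin with (1 :=
    filterdiff_comp'_2 p q h t _ _
      (fun a b => plus (scal a (dx h (p t) (q t))) (scal b (dy h (p t) (q t))))
      Hp Hq (C1_plane_filterdiff U h (p t) (q t) HU Hh Upq)).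
  intro s; unfold plus, scal; simpl; unfold mult; simpl; ring.
Qed.

Lemma continuous_comp_plane (h : R -> R -> R) (p q : R -> R) t :
  continuity_2d_pt h (p t) (q t) -> continuous p t -> continuous q t ->
  continuous (fun s => h (p s) (q s)) t.
Proof.
  intros Hh Hp Hq; apply (continuous_comp_2 p q h t Hp Hq).
  apply continuity_2d_pt_filterlim, Hh.
Qed.

Lemma C1_plane_const (U : R * R -> Prop) (a : R) :
  open U -> C1_plane U (fun _ _ => a).
Proof.
  intro HU; apply (C1_plane_intro U _ (fun _ _ => 0) (fun _ _ => 0) HU);
    intros x y _; try apply (is_derive_const a);
    apply continuity_2d_pt_const.
Qed.

Lemma C1_plane_plus (U : R * R -> Prop) (h k : R -> R -> R) :
  open U -> C1_plane U h -> C1_plane U k ->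
  C1_plane U (fun x y => h x y + k x y).
Proof.
  intros HU Hh Hk.
  apply (C1_plane_intro U _ (fun x y => dx h x y + dx k x y)
    (fun x y => dy h x y + dy k x y) HU); intros x y Uxy;
    destruct (Hh x y Uxy) as (hx & hy & chx & chy);
    destruct (Hk x y Uxy) as (kx & ky & ckx & cky).
  - apply is_derive_plus_R; apply Derive_correct; assumption.
  - apply is_derive_plus_R; apply Derive_correct; assumption.
  - exact (continuity_2d_pt_plus _ _ x y chx ckx).
  - exact (continuity_2d_pt_plus _ _ x y chy cky).
Qed.

Lemma C1_plane_mult (U : R * R -> Prop) (h k : R -> R -> R) :
  open U -> C1_plane U h -> C1_plane U k ->
  C1_plane U (fun x y => h x y * k x y).
Proof.
  intros HU Hh Hk.
  apply (C1_plane_intro U _ (fun x y => dx h x y * k x y + h x y * dx k x y)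
    (fun x y => dy h x y * k x y + h x y * dy k x y) HU); intros x y Uxy;
    assert (ch := C1_plane_continuity U h x y HU Hh Uxy);
    assert (ck := C1_plane_continuity U k x y HU Hk Uxy);
    destruct (Hh x y Uxy) as (hx & hy & chx & chy);
    destruct (Hk x y Uxy) as (kx & ky & ckx & cky).
  - apply (is_derive_mult_R (fun u => h u y) (fun u => k u y));
      apply Derive_correct; assumption.
  - apply (is_derive_mult_R (h x) (k x)); apply Derive_correct; assumption.
  - apply continuity_2d_pt_plus; apply continuity_2d_pt_mult; assumption.
  - apply continuity_2d_pt_plus; apply continuity_2d_pt_mult; assumption.
Qed.

Lemma mixed_partials_comm (U : R * R -> Prop) (h : R -> R -> R) (x y : R) :
  open U -> C2_plane U h -> U (x, y) -> dy (dx h) x y = dx (dy h) x y.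
Proof.
  intros HU (H & Hx & Hy) Uxy; symmetry.
  apply (Schwarz h x y).
  - destruct (open_plane_locally U x y HU Uxy) as [e He].
    exists e; intros u v Hu Hv; assert (Uuv := He u v Hu Hv).
    split; [ | split; [ | split]];
      [ apply (H u v Uuv) | apply (H u v Uuv)
      | apply (Hy u v Uuv) | apply (Hx u v Uuv)].
  - apply (Hy x y Uxy).
  - apply (Hx x y Uxy).
Qed.

(** Here [h] is regarded as a function on R^4, hence the zero derivatives
    along [v] and [t]. *)
Definition part (i : coord) (h : R -> R -> R) : R -> R -> R :=
  match i with cx => dx h | cy => dy h | _ => fun _ _ => 0 end.

Lemma pd_on_plane U i (phi : vec -> R) h p :
  open U -> U (p cx, p cy) ->
  (forall q, U (q cx, q cy) -> phi q = h (q cx) (q cy)) ->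
  pd i phi p = part i h (p cx) (p cy).
Proof.
  intros HU Up E; unfold pd.
  destruct (open_plane_slice U (p cx) (p cy) HU Up) as [Lx Ly].
  destruct i; simpl.
  - erewrite Derive_ext; [apply (Derive_const (h (p cx) (p cy))) | ].
    intro s; exact (E (update p cv s) Up).
  - erewrite Derive_ext; [apply (Derive_const (h (p cx) (p cy))) | ].
    intro s; exact (E (update p ct s) Up).
  - apply Derive_ext_loc; apply filter_imp with (2 := Lx).
    intros s Us; exact (E (update p cx s) Us).
  - apply Derive_ext_loc; apply filter_imp with (2 := Ly).
    intros s Us; exact (E (update p cy s) Us).
Qed.

(** * The Jacobi equation as linearised geodesic equation *)

Lemma sum4_ext (a b : coord -> R) :
  (forall i, a i = b i) -> sum4 a = sum4 b.
Proof. intro E; unfold sum4; rewrite !E; reflexivity. Qed.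

Lemma sum4_plus (a b : coord -> R) :
  sum4 (fun i => a i + b i) = sum4 a + sum4 b.
Proof. unfold sum4; ring. Qed.

Lemma sum4_minus (a b : coord -> R) :
  sum4 (fun i => a i - b i) = sum4 a - sum4 b.
Proof. unfold sum4; ring. Qed.

Lemma is_derive_sum4 (a : coord -> R -> R) (a' : coord -> R) t :
  (forall i, is_derive (a i) t (a' i)) ->
  is_derive (fun s => sum4 (fun i => a i s)) t (sum4 a').
Proof.
  intro H; unfold sum4; repeat apply is_derive_plus_R; apply H.
Qed.

(** The left side is [D^2 J + R(J,c')c'] written out, with [dG] in place of the
    partial derivatives of the symbols and [c1], [c2] in place of [c'], [c''].
    The derivative of the symbols along [c] in [D^2 J] cancels one curvature
    term by their symmetry; the products of symbols cancel after [c2] is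
    eliminated by the geodesic equation. *)
Lemma linearised_geodesic_algebra
    (G : coord -> coord -> coord -> R)
    (dG : coord -> coord -> coord -> coord -> R)
    (c1 c2 J J1 J2 : vec) :
  (forall k i j, G k i j = G k j i) ->
  (forall l k i j, dG l k i j = dG l k j i) ->
  (forall k,
    c2 k + sum4 (fun i => sum4 (fun j => G k i j * c1 i * c1 j)) = 0) ->
  forall k,
  J2 k + sum4 (fun i => sum4 (fun j =>
      (sum4 (fun l => dG l k i j * c1 l) * c1 i + G k i j * c2 i) * J j
      + G k i j * c1 i * J1 j))
  + sum4 (fun i => sum4 (fun j => G k i j * c1 i *
      (J1 j + sum4 (fun a => sum4 (fun b => G j a b * c1 a * J b)))))
  + sum4 (fun h => sum4 (fun i => sum4 (fun j =>
      (dG i k j h - dG j k i h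
       + sum4 (fun m => G k i m * G m j h - G k j m * G m i h))
      * J i * c1 j * c1 h)))
  = J2 k + sum4 (fun i => sum4 (fun j =>
      sum4 (fun l => dG l k i j * J l) * c1 i * c1 j
      + 2 * (G k i j * c1 i * J1 j))).
Proof.
  intros sG sdG geo k.
  assert (E1 : sum4 (fun i => sum4 (fun j => sum4 (fun l => dG l k i j * c1 l)
      * c1 i * J j)) =
    sum4 (fun h => sum4 (fun i => sum4 (fun j => dG j k i h
      * J i * c1 j * c1 h)))).
  { unfold sum4.
    rewrite !(fun l => sdG l k cv ct), !(fun l => sdG l k cv cx),
      !(fun l => sdG l k cv cy), !(fun l => sdG l k ct cx),
      !(fun l => sdG l k ct cy), !(fun l => sdG l k cx cy); ring. }
  assert (E2 : sum4 (fun i => sum4 (fun j => sum4 (fun l => dG l k i j * J l)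
      * c1 i * c1 j)) =
    sum4 (fun h => sum4 (fun i => sum4 (fun j => dG i k j h
      * J i * c1 j * c1 h)))).
  { unfold sum4; ring. }
  (* the geodesic equation eliminates [c2] *)
  assert (E3 : sum4 (fun i => sum4 (fun j => G k i j * c2 i * J j)) =
    - sum4 (fun h => sum4 (fun i => sum4 (fun j =>
       sum4 (fun m => G k i m * G m j h) * J i * c1 j * c1 h)))).
  { transitivity (sum4 (fun m => sum4 (fun i => G k i m * J i *
      - sum4 (fun j => sum4 (fun h => G m j h * c1 j * c1 h))))).
    - apply sum4_ext; intro m; apply sum4_ext; intro i.
      rewrite (sG k m i).
      replace (c2 m)
        with (- sum4 (fun j => sum4 (fun h => G m j h * c1 j * c1 h)))
        by (specialize (geo m); lra).
      ring.
    - unfold sum4; ring. }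
  assert (E4 : sum4 (fun i => sum4 (fun j => G k i j * c1 i *
      sum4 (fun a => sum4 (fun b => G j a b * c1 a * J b)))) =
    sum4 (fun h => sum4 (fun i => sum4 (fun j =>
       sum4 (fun m => G k j m * G m i h) * J i * c1 j * c1 h)))).
  { transitivity (sum4 (fun i => sum4 (fun j => G k i j * c1 i *
      sum4 (fun a => sum4 (fun b => G j b a * c1 a * J b))))).
    - apply sum4_ext; intro i; apply sum4_ext; intro j; f_equal.
      apply sum4_ext; intro a; apply sum4_ext; intro b.
      rewrite sG; reflexivity.
    - unfold sum4; ring. }
  pose (Y := sum4 (fun i => sum4 (fun j => G k i j * c1 i * J1 j))).
  assert (S1 : sum4 (fun i => sum4 (fun j =>
        (sum4 (fun l => dG l k i j * c1 l) * c1 i + G k i j * c2 i) * J j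
        + G k i j * c1 i * J1 j)) =
      sum4 (fun i => sum4 (fun j => sum4 (fun l => dG l k i j * c1 l)
         * c1 i * J j))
      + sum4 (fun i => sum4 (fun j => G k i j * c2 i * J j)) + Y).
  { unfold Y; rewrite <- !sum4_plus; apply sum4_ext; intro i.
    rewrite <- !sum4_plus; apply sum4_ext; intro j; ring. }
  assert (S2 : sum4 (fun i => sum4 (fun j => G k i j * c1 i *
        (J1 j + sum4 (fun a => sum4 (fun b => G j a b * c1 a * J b))))) =
      Y + sum4 (fun i => sum4 (fun j => G k i j * c1 i *
           sum4 (fun a => sum4 (fun b => G j a b * c1 a * J b))))).
  { unfold Y; rewrite <- sum4_plus; apply sum4_ext; intro i.
    rewrite <- sum4_plus; apply sum4_ext; intro j; ring. }
  assert (S3 : sum4 (fun h => sum4 (fun i => sum4 (fun j =>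
        (dG i k j h - dG j k i h
         + sum4 (fun m => G k i m * G m j h - G k j m * G m i h))
        * J i * c1 j * c1 h))) =
      sum4 (fun h => sum4 (fun i => sum4 (fun j =>
         dG i k j h * J i * c1 j * c1 h)))
      - sum4 (fun h => sum4 (fun i => sum4 (fun j =>
         dG j k i h * J i * c1 j * c1 h)))
      + (sum4 (fun h => sum4 (fun i => sum4 (fun j =>
         sum4 (fun m => G k i m * G m j h) * J i * c1 j * c1 h)))
      - sum4 (fun h => sum4 (fun i => sum4 (fun j =>
         sum4 (fun m => G k j m * G m i h) * J i * c1 j * c1 h))))).
  { rewrite <- !sum4_minus, <- sum4_plus; apply sum4_ext; intro h.
    rewrite <- !sum4_minus, <- sum4_plus; apply sum4_ext; intro i.
    rewrite <- !sum4_minus, <- sum4_plus; apply sum4_ext; intro j.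
    rewrite sum4_minus; ring. }
  assert (S4 : sum4 (fun i => sum4 (fun j =>
        sum4 (fun l => dG l k i j * J l) * c1 i * c1 j
        + 2 * (G k i j * c1 i * J1 j))) =
      sum4 (fun i => sum4 (fun j => sum4 (fun l => dG l k i j * J l)
        * c1 i * c1 j)) + (Y + Y)).
  { unfold Y; rewrite <- !sum4_plus; apply sum4_ext; intro i.
    rewrite <- !sum4_plus; apply sum4_ext; intro j; ring. }
  rewrite S1, S2, S3, S4, E1, E2, E3, E4; ring.
Qed.

(** Both metrics are invariant under translations of [v] and [t], so calculus
    on the plane is enough for their symbols. *)
Definition plane_symbols (U : R * R -> Prop) (g : metric)
    (G : coord -> coord -> coord -> R -> R -> R) : Prop :=
  (forall p, region g p <-> U (p cx, p cy)) /\
  (forall k i j p, U (p cx, p cy) -> Gamma g k i j p = G k i j (p cx) (p cy)) /\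
  (forall k i j, C1_plane U (G k i j)) /\
  (forall k i j x y, G k i j x y = G k j i x y).

Definition geodesic_op (G : coord -> coord -> coord -> R -> R -> R) (x y : R)
    (c1 c2 : vec) : vec := fun k =>
  c2 k + sum4 (fun i => sum4 (fun j => G k i j x y * c1 i * c1 j)).

(** The linearisation of [geodesic_op] at a curve, applied to a field [J]. *)
Definition jacobi_op (G : coord -> coord -> coord -> R -> R -> R) (x y : R)
    (c1 J J1 J2 : vec) : vec := fun k =>
  J2 k + sum4 (fun i => sum4 (fun j =>
    sum4 (fun l => part l (G k i j) x y * J l) * c1 i * c1 j
    + 2 * (G k i j x y * c1 i * J1 j))).

Lemma part_ext i (h k : R -> R -> R) x y :
  (forall x y, h x y = k x y) -> part i h x y = part i k x y.
Proof.
  intro E; destruct i; simpl; try reflexivity; apply Derive_ext; auto.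
Qed.

Lemma geodesic_iff U g G c :
  plane_symbols U g G ->
  geodesic g c <->
  open_interval (dom c) /\
  (forall k, C2_on (dom c) (fun t => pt c t k)) /\
  forall t, dom c t -> U (pt c t cx, pt c t cy) /\
    forall k, geodesic_op G (pt c t cx) (pt c t cy)
      (velocity (pt c) t) (velocity (velocity (pt c)) t) k = 0.
Proof.
  intros (Hr & HG & _ & _); unfold geodesic.
  split; intros (HI & HC & H); (split; [exact HI | split; [exact HC | ]]);
    intros t It; destruct (H t It) as [Ht E].
  - apply Hr in Ht; split; [exact Ht | ]; intro k; rewrite <- (E k).
    unfold geodesic_op, covD; f_equal.
    apply sum4_ext; intro i; apply sum4_ext; intro j.
    rewrite HG; [reflexivity | exact Ht].
  - split; [apply Hr, Ht | ]; intro k; rewrite <- (E k).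
    unfold geodesic_op, covD; f_equal.
    apply sum4_ext; intro i; apply sum4_ext; intro j.
    rewrite HG; [reflexivity | exact Ht].
Qed.

Lemma is_derive_comp_part U h (c : R -> vec) t :
  open U -> C1_plane U h -> U (c t cx, c t cy) ->
  (forall i, is_derive (fun s => c s i) t (velocity c t i)) ->
  is_derive (fun s => h (c s cx) (c s cy)) t
    (sum4 (fun l => part l h (c t cx) (c t cy) * velocity c t l)).
Proof.
  intros HU Hh Ht Hc.
  replace (sum4 _) with (dx h (c t cx) (c t cy) * velocity c t cx
    + dy h (c t cx) (c t cy) * velocity c t cy) by (unfold sum4; simpl; ring).
  apply (is_derive_comp_plane U h (fun s => c s cx) (fun s => c s cy));
    auto.
Qed.

(** The linearised form is built from the symbols and their first derivatives
    alone, so the effect of a conformal change on it can be computed term by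
    term. *)
Lemma jacobi_equation_linearised U g G c J t k :
  open U -> plane_symbols U g G -> geodesic g c ->
  (forall k, C2_on (dom c) (fun t => J t k)) -> dom c t ->
  covD g (pt c) (covD g (pt c) J) t k +
    curvature g (pt c t) (J t) (velocity (pt c) t) (velocity (pt c) t) k =
  jacobi_op G (pt c t cx) (pt c t cy)
    (velocity (pt c) t) (J t) (velocity J t) (velocity (velocity J) t) k.
Proof.
  intros HU HG Hc HJ It.
  assert (Hgeo := proj1 (geodesic_iff U g G c HG) Hc).
  destruct HG as (Hr & HG & G1 & Gs); destruct Hgeo as (HI & HC & Hgeo).
  assert (Ut := proj1 (Hgeo t It)).
  assert (dc : forall s, dom c s -> forall i,
      is_derive (fun s => pt c s i) s (velocity (pt c) s i))
    by (intros s Is i; exact (C2_on_derive _ _ s (HC i) Is)).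
  assert (dJ : forall s, dom c s -> forall i,
      is_derive (fun s => J s i) s (velocity J s i))
    by (intros s Is i; exact (C2_on_derive _ _ s (HJ i) Is)).
  assert (ED : forall k, covD g (pt c) (covD g (pt c) J) t k =
    velocity (velocity J) t k + sum4 (fun i => sum4 (fun j =>
      (sum4 (fun l => part l (G k i j) (pt c t cx) (pt c t cy)
          * velocity (pt c) t l) * velocity (pt c) t i
       + G k i j (pt c t cx) (pt c t cy) * velocity (velocity (pt c)) t i)
      * J t j
      + G k i j (pt c t cx) (pt c t cy) * velocity (pt c) t i
        * velocity J t j))
    + sum4 (fun i => sum4 (fun j => G k i j (pt c t cx) (pt c t cy)
      * velocity (pt c) t i * (velocity J t j + sum4 (fun a => sum4 (fun b =>
         G j a b (pt c t cx) (pt c t cy) * velocity (pt c) t a * J t b)))))).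
  { clear k; intro k; unfold covD at 1; f_equal.
    - apply is_derive_unique.
      apply is_derive_ext_loc with (fun s => velocity J s k +
        sum4 (fun i => sum4 (fun j => G k i j (pt c s cx) (pt c s cy)
          * velocity (pt c) s i * J s j))).
      + apply filter_imp with (2 := open_interval_locally _ t HI It).
        intros s Is; unfold covD; f_equal.
        apply sum4_ext; intro i; apply sum4_ext; intro j.
        rewrite HG; [reflexivity | apply (Hgeo s Is)].
      + apply is_derive_plus_R.
        { exact (C2_on_derive2 _ _ t (HJ k) It). }
        apply is_derive_sum4; intro i; apply is_derive_sum4; intro j.
        apply (is_derive_mult_R (fun s => G k i j (pt c s cx) (pt c s cy)
          * velocity (pt c) s i) (fun s => J s j)); [ | apply dJ, It].
        apply (is_derive_mult_R (fun s => G k i j (pt c s cx) (pt c s cy))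
          (fun s => velocity (pt c) s i)).
        * apply (is_derive_comp_part U); auto.
        * exact (C2_on_derive2 _ _ t (HC i) It).
    - apply sum4_ext; intro i; apply sum4_ext; intro j.
      rewrite HG by exact Ut; f_equal; unfold covD; f_equal.
      apply sum4_ext; intro a; apply sum4_ext; intro b.
      rewrite HG by exact Ut; reflexivity. }
  rewrite ED; unfold jacobi_op.
  rewrite <- (linearised_geodesic_algebra
    (fun k i j => G k i j (pt c t cx) (pt c t cy))
    (fun l k i j => part l (G k i j) (pt c t cx) (pt c t cy))
    (velocity (pt c) t) (velocity (velocity (pt c)) t)
    (J t) (velocity J t) (velocity (velocity J) t)).
  - f_equal; unfold curvature, Riem.
    apply sum4_ext; intro h; apply sum4_ext; intro i; apply sum4_ext; intro j.
    rewrite (pd_on_plane U i _ (G k j h) _ HU Ut (HG k j h)).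
    rewrite (pd_on_plane U j _ (G k i h) _ HU Ut (HG k i h)).
    f_equal; f_equal; f_equal; f_equal; apply sum4_ext; intro m.
    rewrite !HG by exact Ut; reflexivity.
  - intros; apply Gs.
  - intros; apply part_ext; intros; apply Gs.
  - exact (proj2 (Hgeo t It)).
Qed.

(** * The Christoffel symbols of the two metrics *)

Definition gS_plane (V : R -> R -> R) (i j : coord) (x y : R) : R :=
  gS_lower V (vec4 0 0 x y) i j.

Definition gS_symbols (V : R -> R -> R) (k i j : coord) (x y : R) : R :=
  match k, i, j with
  | cv, ct, cx | cv, cx, ct => - dx V x y
  | cv, ct, cy | cv, cy, ct => - dy V x y
  | cx, ct, ct => - dx V x y
  | cy, ct, ct => dy V x y
  | _, _, _ => 0
  end.

(** Component [k] of the gradient of [f] with respect to [gS]. *)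
Definition gS_grad (f : R -> R -> R) (k : coord) (x y : R) : R :=
  match k with cx => - dx f x y | cy => dy f x y | _ => 0 end.

Definition delta (i j : coord) : R := if coord_eq_dec i j then 1 else 0.

(** The rule by which the Levi-Civita connection changes when the metric is
    multiplied by [exp (2 f)]. *)
Definition conformal_symbols (f V : R -> R -> R) (k i j : coord) (x y : R)
    : R :=
  gS_symbols V k i j x y
  + (delta k i * part j f x y + delta k j * part i f x y
     - gS_plane V i j x y * gS_grad f k x y).

Lemma part_gS_plane V l i j x y :
  part l (gS_plane V i j) x y =
  match i, j with ct, ct => - 2 * part l V x y | _, _ => 0 end.
Proof.
  assert (c0 : forall a, part l (fun _ _ => a) x y = 0)
    by (intro a; destruct l; try reflexivity; exact (Derive_const a _)).
  destruct i, j; try exact (c0 _).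
  destruct l; try (simpl; ring).
  - exact (Derive_scal (fun u => V u y) (- 2) x).
  - exact (Derive_scal (fun u => V x u) (- 2) y).
Qed.

Lemma part_conformal_plane f V l i j x y :
  ex_derive (fun u => f u y) x -> ex_derive (fun u => f x u) y ->
  ex_derive (fun u => V u y) x -> ex_derive (fun u => V x u) y ->
  part l (fun x y => exp (2 * f x y) * gS_plane V i j x y) x y =
  exp (2 * f x y) *
    (2 * part l f x y * gS_plane V i j x y + part l (gS_plane V i j) x y).
Proof.
  intros fx fy Vx Vy.
  assert (ex : ex_derive (fun u => gS_plane V i j u y) x)
    by (destruct i, j; try exact (ex_derive_const _ _);
        exact (ex_derive_scal (fun u => V u y) (- 2) x Vx)).
  assert (ey : ex_derive (fun u => gS_plane V i j x u) y)
    by (destruct i, j; try exact (ex_derive_const _ _);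
        exact (ex_derive_scal (fun u => V x u) (- 2) y Vy)).
  destruct l; simpl; try ring; apply is_derive_unique.
  - apply Derive_correct in fx; apply Derive_correct in ex.
    auto_derive.
    + repeat split; [exists (dx f x y); exact fx | exact (ex_intro _ _ ex)].
    + unfold dx; ring.
  - apply Derive_correct in fy; apply Derive_correct in ey.
    auto_derive.
    + repeat split; [exists (dy f x y); exact fy | exact (ex_intro _ _ ey)].
    + unfold dy; ring.
Qed.

Lemma gS_symbols_correct U V k i j p :
  open U -> U (p cx, p cy) ->
  Gamma (gS U V) k i j p = gS_symbols V k i j (p cx) (p cy).
Proof.
  intros HU Up.
  assert (E : forall l i j, pd l (fun q => lower (gS U V) q i j) p =
      match i, j with ct, ct => - 2 * part l V (p cx) (p cy) | _, _ => 0 end).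
  { intros l i' j'; rewrite <- part_gS_plane.
    apply (pd_on_plane U); auto. }
  unfold Gamma, sum4; rewrite !E.
  destruct k, i, j; simpl; field.
Qed.

Lemma conformal_symbols_correct U f V k i j p :
  open U -> C1_plane U f -> C1_plane U V -> U (p cx, p cy) ->
  Gamma (conformal (on_R4 f) (gS U V)) k i j p =
    conformal_symbols f V k i j (p cx) (p cy).
Proof.
  intros HU Hf HV Up.
  destruct (Hf _ _ Up) as (fx & fy & _); destruct (HV _ _ Up) as (Vx & Vy & _).
  pose (e := exp (2 * f (p cx) (p cy))).
  pose (D := fun l i j => 2 * part l f (p cx) (p cy) * gS_lower V p i j +
    match i, j with ct, ct => - 2 * part l V (p cx) (p cy) | _, _ => 0 end).
  assert (E : forall l i j,
      pd l (fun q => lower (conformal (on_R4 f) (gS U V)) q i j) p =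
      e * D l i j).
  { intros l i' j'.
    rewrite (pd_on_plane U l _
      (fun x y => exp (2 * f x y) * gS_plane V i' j' x y)) by auto.
    rewrite part_conformal_plane by assumption.
    rewrite part_gS_plane; reflexivity. }
  assert (He : e <> 0) by apply Rgt_not_eq, exp_pos.
  transitivity (/ 2 * sum4 (fun l => gS_upper V p k l *
    (D i j l + D j i l - D l i j))).
  - unfold Gamma, sum4; rewrite !E.
    change (upper (conformal (on_R4 f) (gS U V)) p k)
      with (fun l => / e * gS_upper V p k l); cbv beta.
    field; exact He.
  - unfold D, sum4, conformal_symbols, delta, gS_plane.
    destruct k, i, j; simpl; field.
Qed.

Lemma C1_plane_opp U h :
  open U -> C1_plane U h -> C1_plane U (fun x y => - h x y).
Proof.
  intros HU Hh.
  apply (C1_plane_intro U _ (fun x y => - dx h x y) (fun x y => - dy h x y) HU);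
    intros x y Uxy; destruct (Hh x y Uxy) as (hx & hy & chx & chy).
  - apply (is_derive_opp (fun u => h u y)), Derive_correct, hx.
  - apply (is_derive_opp (h x)), Derive_correct, hy.
  - apply continuity_2d_pt_opp, chx.
  - apply continuity_2d_pt_opp, chy.
Qed.

Lemma C1_part U h i : open U -> C2_plane U h -> C1_plane U (part i h).
Proof.
  intros HU (_ & Hx & Hy); destruct i;
    [exact (C1_plane_const U 0 HU) | exact (C1_plane_const U 0 HU)
    | exact Hx | exact Hy].
Qed.

Lemma C1_gS_symbols U V k i j :
  open U -> C2_plane U V -> C1_plane U (gS_symbols V k i j).
Proof.
  intros HU (_ & Hx & Hy).
  assert (c0 := C1_plane_const U 0 HU).
  assert (ox := C1_plane_opp U (dx V) HU Hx).
  assert (oy := C1_plane_opp U (dy V) HU Hy).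
  destruct k, i, j; unfold gS_symbols;
    match goal with
    | |- C1_plane U (fun _ _ => 0) => exact c0
    | |- C1_plane U (fun x y => - dx V x y) => exact ox
    | |- C1_plane U (fun x y => - dy V x y) => exact oy
    | _ => exact Hy
    end.
Qed.

Lemma C1_gS_plane U V i j :
  open U -> C1_plane U V -> C1_plane U (gS_plane V i j).
Proof.
  intros HU HV.
  assert (c := fun a => C1_plane_const U a HU).
  destruct i, j; try exact (c _).
  exact (C1_plane_mult U (fun _ _ => - 2) V HU (c _) HV).
Qed.

Lemma C1_gS_grad U f k :
  open U -> C2_plane U f -> C1_plane U (gS_grad f k).
Proof.
  intros HU (_ & Hx & Hy); destruct k.
  - exact (C1_plane_const U 0 HU).
  - exact (C1_plane_const U 0 HU).
  - exact (C1_plane_opp U (dx f) HU Hx).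
  - exact Hy.
Qed.

Lemma gS_plane_symbols U V :
  open U -> C2_plane U V -> plane_symbols U (gS U V) (gS_symbols V).
Proof.
  intros HU HV; split; [reflexivity | split; [ | split]].
  - intros; apply gS_symbols_correct; assumption.
  - intros; apply C1_gS_symbols; assumption.
  - intros k i j x y; destruct k, i, j; reflexivity.
Qed.

Lemma conformal_plane_symbols U f V :
  open U -> C2_plane U f -> C2_plane U V ->
  plane_symbols U (conformal (on_R4 f) (gS U V)) (conformal_symbols f V).
Proof.
  intros HU Hf HV; split; [reflexivity | split; [ | split]].
  - intros; apply conformal_symbols_correct; try assumption;
      [apply Hf | apply HV].
  - intros k i j.
    assert (Hd : forall a b l, C1_plane U (fun x y => delta a b * part l f x y))
      by (intros a b l; exact (C1_plane_mult U (fun _ _ => delta a b) _ HU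
          (C1_plane_const U _ HU) (C1_part U f l HU Hf))).
    apply C1_plane_plus; [assumption | apply C1_gS_symbols; assumption | ].
    apply C1_plane_plus; [assumption | apply C1_plane_plus; auto | ].
    apply C1_plane_opp; [assumption | ].
    apply C1_plane_mult; [assumption | apply C1_gS_plane; [ | apply HV] |
      apply C1_gS_grad]; assumption.
  - intros k i j x y; unfold conformal_symbols.
    replace (gS_symbols V k j i x y) with (gS_symbols V k i j x y)
      by (destruct k, i, j; reflexivity).
    replace (gS_plane V j i x y) with (gS_plane V i j x y)
      by (destruct i, j; reflexivity).
    ring.
Qed.

(** * Null geodesics and the complex equation of motion *)

Lemma is_derive_C_iff (z : R -> C) t (w : C) :
  is_derive (V := C_R_NormedModule) z t w <->
  is_derive (fun s => Re (z s)) t (Re w) /\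
  is_derive (fun s => Im (z s)) t (Im w).
Proof.
  split.
  - intro H; split.
    + apply filterdiff_ext_lin with (1 := filterdiff_comp' z
        (fun u : prod_NormedModule R_AbsRing R_NormedModule R_NormedModule
         => fst u) t _ _ H (filterdiff_linear _ is_linear_fst)).
      reflexivity.
    + apply filterdiff_ext_lin with (1 := filterdiff_comp' z
        (fun u : prod_NormedModule R_AbsRing R_NormedModule R_NormedModule
         => snd u) t _ _ H (filterdiff_linear _ is_linear_snd)).
      reflexivity.
  - intros [Hr Hi].
    apply filterdiff_ext with (fun s => (Re (z s), Im (z s)));
      [intro s; destruct (z s); reflexivity | ].
    apply filterdiff_ext_lin with (fun y : R => (scal y (Re w), scal y (Im w)));
      [ | intro s; destruct w; reflexivity].
    apply (filterdiff_comp'_2 (fun s => Re (z s)) (fun s => Im (z s))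
      (fun a b => (a, b)
        : prod_NormedModule R_AbsRing R_NormedModule R_NormedModule) t _ _
      (fun a b => (a, b)) Hr Hi).
    apply filterdiff_ext with (fun u => u); [intros [a b]; reflexivity | ].
    apply filterdiff_ext_lin with (fun u => u); [ | intros [a b]; reflexivity].
    apply filterdiff_id.
Qed.

Lemma pair_Re_Im (z : C) : (Re z, Im z) = z.
Proof. destruct z; reflexivity. Qed.

Lemma solution_iff U V z :
  solution U V z <->
  open_interval (dom z) /\ exists x1 y1 : R -> R, forall t, dom z t ->
    U (Re (pt z t), Im (pt z t)) /\
    is_derive (fun s => Re (pt z s)) t (x1 t) /\
    is_derive (fun s => Im (pt z s)) t (y1 t) /\
    is_derive x1 t (dx V (Re (pt z t)) (Im (pt z t))) /\
    is_derive y1 t (- dy V (Re (pt z t)) (Im (pt z t))).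
Proof.
  assert (FR : forall z, Re (F V z) = dx V (Re z) (Im z))
    by (intro; unfold F; simpl; ring).
  assert (FI : forall z, Im (F V z) = - dy V (Re z) (Im z))
    by (intro; unfold F; simpl; ring).
  split; intros (HI & H); (split; [exact HI | ]).
  - destruct H as (w & H); exists (fun t => Re (w t)), (fun t => Im (w t)).
    intros t It; destruct (H t It) as (Ut & H1 & H2).
    rewrite pair_Re_Im, <- FR, <- FI.
    apply is_derive_C_iff in H1; apply is_derive_C_iff in H2; tauto.
  - destruct H as (x1 & y1 & H); exists (fun t => (x1 t, y1 t)).
    intros t It; destruct (H t It) as (Ut & Hx & Hy & Hx1 & Hy1).
    rewrite pair_Re_Im in Ut; split; [exact Ut | split].
    + apply is_derive_C_iff; split; assumption.
    + apply is_derive_C_iff; rewrite FR, FI; split; assumption.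
Qed.

Lemma gS_geodesic_op V x y c1 c2 :
  geodesic_op (gS_symbols V) x y c1 c2 cv =
    c2 cv - 2 * (dx V x y * c1 cx + dy V x y * c1 cy) * c1 ct /\
  geodesic_op (gS_symbols V) x y c1 c2 ct = c2 ct /\
  geodesic_op (gS_symbols V) x y c1 c2 cx = c2 cx - dx V x y * c1 ct ^ 2 /\
  geodesic_op (gS_symbols V) x y c1 c2 cy = c2 cy + dy V x y * c1 ct ^ 2.
Proof.
  unfold geodesic_op, sum4; simpl; repeat split; ring.
Qed.

(** Since [t'' = 0] for [gS], a geodesic with [t' = 1] at one point is
    parametrised by [t]; its equations in [x] and [y] are then [z'' = F z]. *)
Record normal_geodesic (U : R * R -> Prop) (V : R -> R -> R) (c : curve vec)
    : Prop := {
  ng_interval : open_interval (dom c);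
  ng_C2 : forall k, C2_on (dom c) (fun t => pt c t k);
  ng_region : forall t, dom c t -> U (pt c t cx, pt c t cy);
  ng_t : forall t, dom c t -> pt c t ct = t;
  ng_t1 : forall t, dom c t -> velocity (pt c) t ct = 1;
  ng_v : forall t, dom c t -> velocity (velocity (pt c)) t cv =
    2 * (dx V (pt c t cx) (pt c t cy) * velocity (pt c) t cx
         + dy V (pt c t cx) (pt c t cy) * velocity (pt c) t cy);
  ng_x : forall t, dom c t ->
    velocity (velocity (pt c)) t cx = dx V (pt c t cx) (pt c t cy);
  ng_y : forall t, dom c t ->
    velocity (velocity (pt c)) t cy = - dy V (pt c t cx) (pt c t cy)
}.

Lemma velocity_derive (c : curve vec) k t :
  (forall k, C2_on (dom c) (fun t => pt c t k)) -> dom c t ->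
  is_derive (fun s => pt c s k) t (velocity (pt c) t k).
Proof. intros HC It; exact (C2_on_derive _ _ t (HC k) It). Qed.

Lemma velocity_derive2 (c : curve vec) k t :
  (forall k, C2_on (dom c) (fun t => pt c t k)) -> dom c t ->
  is_derive (fun s => velocity (pt c) s k) t (velocity (velocity (pt c)) t k).
Proof. intros HC It; exact (C2_on_derive2 _ _ t (HC k) It). Qed.

Lemma geodesic_normal U V c t0 :
  open U -> C2_plane U V -> geodesic (gS U V) c ->
  dom c t0 -> pt c t0 ct = t0 -> velocity (pt c) t0 ct = 1 ->
  normal_geodesic U V c.
Proof.
  intros HU HV Hc I0 E0 E1.
  apply (geodesic_iff U _ _ c (gS_plane_symbols U V HU HV)) in Hc.
  destruct Hc as (HI & HC & Hgeo).
  assert (t1 : forall t, dom c t -> velocity (pt c) t ct = 1).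
  { intros t It; rewrite <- E1.
    apply (derive_zero_const (dom c) (fun s => velocity (pt c) s ct));
      try assumption.
    intros s Is; destruct (Hgeo s Is) as [_ E].
    specialize (E ct); rewrite (proj1 (proj2 (gS_geodesic_op _ _ _ _ _))) in E.
    rewrite <- E; exact (velocity_derive2 c ct s HC Is). }
  split; try assumption.
  - apply Hgeo.
  - intros t It.
    apply (same_derivative_eq (dom c) (fun s => pt c s ct) (fun s => s)
      (fun _ => 1) t0 t HI); try assumption.
    + intros s Is; rewrite <- (t1 s Is); apply velocity_derive; assumption.
    + intros s _; apply (is_derive_id s).
  - intros t It; destruct (Hgeo t It) as [_ E]; specialize (E cv).
    rewrite (proj1 (gS_geodesic_op _ _ _ _ _)), t1 in E by exact It; lra.
  - intros t It; destruct (Hgeo t It) as [_ E]; specialize (E cx).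
    rewrite (proj1 (proj2 (proj2 (gS_geodesic_op _ _ _ _ _)))), t1 in E
      by exact It; lra.
  - intros t It; destruct (Hgeo t It) as [_ E]; specialize (E cy).
    rewrite (proj2 (proj2 (proj2 (gS_geodesic_op _ _ _ _ _)))), t1 in E
      by exact It; lra.
Qed.

(** On a null geodesic parametrised by [t], [v'] is the Lagrangian of the
    motion of [z]. *)
Definition lagrangian (V : R -> R -> R) (x y x1 y1 : R) : R :=
  V x y + / 2 * (x1 * x1 - y1 * y1).

Lemma gS_lightlike_iff U V p X :
  X ct = 1 ->
  lightlike (gS U V) p X <->
  X cv = lagrangian V (p cx) (p cy) (X cx) (X cy).
Proof.
  intro E; unfold lightlike, lagrangian; rewrite gS_quadratic, E; split.
  - intros [_ H]; lra.
  - intro H; split; [exists ct; lra | rewrite H; field].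
Qed.

(** By the equations of motion potential and kinetic part contribute equally.
    The sum is the second derivative of [v] prescribed by the geodesic
    equation. *)
Lemma is_derive_lagrangian U V (x y x1 y1 : R -> R) t :
  open U -> C1_plane U V -> U (x t, y t) ->
  is_derive x t (x1 t) -> is_derive y t (y1 t) ->
  is_derive x1 t (dx V (x t) (y t)) -> is_derive y1 t (- dy V (x t) (y t)) ->
  is_derive (fun s => lagrangian V (x s) (y s) (x1 s) (y1 s)) t
    (2 * (dx V (x t) (y t) * x1 t + dy V (x t) (y t) * y1 t)).
Proof.
  intros HU HV Ut Hx Hy Hx1 Hy1; unfold lagrangian.
  assert (HVt := is_derive_comp_plane U V x y t _ _ HU HV Ut Hx Hy).
  evar_last.
  - apply is_derive_plus_R; [exact HVt | ].
    apply (is_derive_scal (fun s => x1 s * x1 s - y1 s * y1 s)).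
    apply (is_derive_minus (fun s => x1 s * x1 s) (fun s => y1 s * y1 s));
      apply is_derive_mult_R; eassumption.
  - unfold minus, plus, opp; simpl; field.
Qed.

Definition z_curve (c : curve vec) : curve C :=
  Curve (dom c) (fun t => (pt c t cx, pt c t cy)).

Lemma z_curve_solution U V c :
  normal_geodesic U V c -> solution U V (z_curve c).
Proof.
  intro Hc; apply solution_iff; split; [apply Hc | ].
  exists (fun t => velocity (pt c) t cx), (fun t => velocity (pt c) t cy).
  intros t It; simpl; split; [ | split; [ | split; [ | split]]].
  - apply (ng_region U V c Hc t It).
  - apply velocity_derive; [apply Hc | exact It].
  - apply velocity_derive; [apply Hc | exact It].
  - assert (D := velocity_derive2 c cx t (ng_C2 U V c Hc) It).
    rewrite (ng_x U V c Hc t It) in D; exact D.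
  - assert (D := velocity_derive2 c cy t (ng_C2 U V c Hc) It).
    rewrite (ng_y U V c Hc t It) in D; exact D.
Qed.

Definition lift_integrand (V : R -> R -> R) (z : curve C) (s : R) : R :=
  lagrangian V (Re (pt z s)) (Im (pt z s))
    (Derive (fun s => Re (pt z s)) s) (Derive (fun s => Im (pt z s)) s).

Definition lift (V : R -> R -> R) (t0 : R) (z : curve C) : curve vec :=
  Curve (dom z) (fun t =>
    vec4 (RInt (lift_integrand V z) t0 t) t (Re (pt z t)) (Im (pt z t))).

Lemma solution_derive U V z t :
  solution U V z -> dom z t ->
  U (Re (pt z t), Im (pt z t)) /\
  is_derive (fun s => Re (pt z s)) t (Derive (fun s => Re (pt z s)) t) /\
  is_derive (fun s => Im (pt z s)) t (Derive (fun s => Im (pt z s)) t) /\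
  is_derive (Derive (fun s => Re (pt z s))) t
    (dx V (Re (pt z t)) (Im (pt z t))) /\
  is_derive (Derive (fun s => Im (pt z s))) t
    (- dy V (Re (pt z t)) (Im (pt z t))).
Proof.
  intros Hz It; apply solution_iff in Hz; destruct Hz as (HI & x1 & y1 & H).
  split; [apply (H t It) | split; [ | split; [ | split]]].
  - apply Derive_correct; exists (x1 t); apply (H t It).
  - apply Derive_correct; exists (y1 t); apply (H t It).
  - apply (Derive2_on (dom z) _ x1
      (fun t => dx V (Re (pt z t)) (Im (pt z t)))); try assumption; apply H.
  - apply (Derive2_on (dom z) _ y1
      (fun t => - dy V (Re (pt z t)) (Im (pt z t)))); try assumption; apply H.
Qed.

Lemma solution_continuous U V z h t :
  open U -> C1_plane U h -> solution U V z -> dom z t ->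
  continuous (fun s => h (Re (pt z s)) (Im (pt z s))) t.
Proof.
  intros HU Hh Hz It.
  destruct (solution_derive U V z t Hz It) as (Ut & Hx & Hy & _).
  exact (is_derive_continuous _ t _
    (is_derive_comp_plane U h _ _ t _ _ HU Hh Ut Hx Hy)).
Qed.

Lemma is_derive_lift_integrand U V z t :
  open U -> C2_plane U V -> solution U V z -> dom z t ->
  is_derive (lift_integrand V z) t
    (2 * (dx V (Re (pt z t)) (Im (pt z t)) * Derive (fun s => Re (pt z s)) t
        + dy V (Re (pt z t)) (Im (pt z t)) * Derive (fun s => Im (pt z s)) t)).
Proof.
  intros HU HV Hz It.
  destruct (solution_derive U V z t Hz It) as (Ut & Hx & Hy & Hx1 & Hy1).
  apply (is_derive_lagrangian U); try assumption; apply HV.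
Qed.

Lemma lift_derive U V t0 z t :
  open U -> C2_plane U V -> solution U V z -> dom z t0 -> dom z t ->
  forall k, is_derive (fun s => pt (lift V t0 z) s k) t
    (vec4 (lift_integrand V z t) 1 (Derive (fun s => Re (pt z s)) t)
       (Derive (fun s => Im (pt z s)) t) k).
Proof.
  intros HU HV Hz I0 It.
  destruct (solution_derive U V z t Hz It) as (Ut & Hx & Hy & _).
  intros []; simpl; try assumption.
  - apply (is_derive_RInt_interval (dom z)); try assumption; [apply Hz | ].
    intros s Is; apply (is_derive_continuous _ s _
      (is_derive_lift_integrand U V z s HU HV Hz Is)).
  - apply (is_derive_id t).
Qed.

Lemma lift_derive2 U V t0 z t :
  open U -> C2_plane U V -> solution U V z -> dom z t0 -> dom z t ->
  forall k, is_derive (fun s => vec4 (lift_integrand V z s) 1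
       (Derive (fun s => Re (pt z s)) s) (Derive (fun s => Im (pt z s)) s) k) t
    (vec4 (2 * (dx V (Re (pt z t)) (Im (pt z t))
                  * Derive (fun s => Re (pt z s)) t
              + dy V (Re (pt z t)) (Im (pt z t))
                  * Derive (fun s => Im (pt z s)) t))
       0 (dx V (Re (pt z t)) (Im (pt z t)))
       (- dy V (Re (pt z t)) (Im (pt z t))) k).
Proof.
  intros HU HV Hz I0 It.
  destruct (solution_derive U V z t Hz It) as (_ & _ & _ & Hx1 & Hy1).
  intros []; simpl; try assumption.
  - exact (is_derive_lift_integrand U V z t HU HV Hz It).
  - apply (is_derive_const 1).
Qed.

Lemma lift_velocity U V t0 z t :
  open U -> C2_plane U V -> solution U V z -> dom z t0 -> dom z t ->
  forall k, velocity (pt (lift V t0 z)) t k =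
    vec4 (lift_integrand V z t) 1 (Derive (fun s => Re (pt z s)) t)
       (Derive (fun s => Im (pt z s)) t) k.
Proof.
  intros HU HV Hz I0 It k.
  exact (is_derive_unique _ _ _ (lift_derive U V t0 z t HU HV Hz I0 It k)).
Qed.

Lemma lift_null_geodesic U V t0 z :
  open U -> C2_plane U V -> solution U V z -> dom z t0 ->
  lightlike_geodesic (gS U V) (lift V t0 z).
Proof.
  intros HU HV Hz I0; assert (HI := proj1 Hz).
  assert (d1 := fun k t It => lift_derive U V t0 z t HU HV Hz I0 It k).
  assert (d2 := fun k t It => lift_derive2 U V t0 z t HU HV Hz I0 It k).
  assert (v1 := fun t It => lift_velocity U V t0 z t HU HV Hz I0 It).
  split.
  - apply (geodesic_iff U _ _ _ (gS_plane_symbols U V HU HV)).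
    split; [exact HI | split].
    + intro k; apply (C2_on_intro (dom z) _ _ _ HI (d1 k) (d2 k)).
      intros t It.
      destruct (solution_derive U V z t Hz It) as (_ & _ & _ & Hx1 & Hy1).
      assert (cx' := solution_continuous U V z (dx V) t HU
        (proj1 (proj2 HV)) Hz It).
      assert (cy' := solution_continuous U V z (dy V) t HU
        (proj2 (proj2 HV)) Hz It).
      assert (cx1 := is_derive_continuous _ t _ Hx1).
      assert (cy1 := is_derive_continuous _ t _ Hy1).
      destruct k; simpl.
      * apply (continuous_mult_R (fun _ => 2)); [apply continuous_const | ].
        exact (continuous_plus_R _ _ t (continuous_mult_R _ _ t cx' cx1)
          (continuous_mult_R _ _ t cy' cy1)).
      * apply continuous_const.
      * exact cx'.
      * apply (continuous_opp (fun s => dy V (Re (pt z s)) (Im (pt z s)))).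
        exact cy'.
    + intros t It; split; [apply (solution_derive U V z t Hz It) | ].
      assert (v2 : forall k, velocity (velocity (pt (lift V t0 z))) t k = _)
        by (intro k; exact (is_derive_unique _ _ _
              (Derive2_on (dom z) _ _ _ t HI (d1 k) (d2 k) It))).
      destruct (gS_geodesic_op V (pt (lift V t0 z) t cx) (pt (lift V t0 z) t cy)
        (velocity (pt (lift V t0 z)) t)
        (velocity (velocity (pt (lift V t0 z))) t)) as (Ev & Et & Ex & Ey).
      intros []; [rewrite Ev | rewrite Et | rewrite Ex | rewrite Ey];
        rewrite v2, ?(v1 t It); simpl; ring.
  - intros t It; apply gS_lightlike_iff; rewrite !(v1 t It); reflexivity.
Qed.

Lemma lift_initial U V t0 z z0 dz0 :
  open U -> C2_plane U V -> solution U V z -> initial_z t0 z0 dz0 z ->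
  initial_geodesic V t0 z0 dz0 (lift V t0 z).
Proof.
  intros HU HV Hz (I0 & E0 & D0); split; [exact I0 | split].
  - intros []; simpl; rewrite ?E0; try reflexivity.
    exact (RInt_point t0 (lift_integrand V z)).
  - intro k; rewrite (lift_velocity U) by assumption.
    apply is_derive_C_iff in D0; destruct D0 as [Dx Dy].
    assert (Ex : Derive (fun s => Re (pt z s)) t0 = Re dz0)
      by exact (is_derive_unique _ _ _ Dx).
    assert (Ey : Derive (fun s => Im (pt z s)) t0 = Im dz0)
      by exact (is_derive_unique _ _ _ Dy).
    unfold lift_integrand, lagrangian; rewrite Ex, Ey, E0.
    destruct k; simpl; try reflexivity; field.
Qed.

(** Along a null geodesic the coordinate [v] is recovered from [z] by
    integrating the Lagrangian. *)
Lemma null_geodesic_extends_lift U V t0 e z :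
  open U -> C2_plane U V -> solution U V z -> dom z t0 ->
  normal_geodesic U V e -> lightlike_geodesic (gS U V) e ->
  dom e t0 -> pt e t0 cv = 0 -> extends (z_curve e) z ->
  extends e (lift V t0 z).
Proof.
  intros HU HV Hz I0 He Hl Ie0 E0 Hext.
  assert (Ed : forall t, dom e t -> dom z t)
    by (intros t It; apply (Hext t It)).
  assert (Ex : forall t, dom e t -> Re (pt z t) = pt e t cx)
    by (intros t It; rewrite (proj2 (Hext t It)); reflexivity).
  assert (Ey : forall t, dom e t -> Im (pt z t) = pt e t cy)
    by (intros t It; rewrite (proj2 (Hext t It)); reflexivity).
  assert (HI := ng_interval U V e He).
  assert (D : forall (p q : R -> R), (forall t, dom e t -> p t = q t) ->
      forall t, dom e t -> Derive p t = Derive q t).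
  { intros p q E t It; apply Derive_ext_loc.
    exact (filter_imp _ _ E (open_interval_locally _ t HI It)). }
  intros t It; split; [exact (Ed t It) | ].
  apply functional_extensionality; intros []; simpl.
  - symmetry.
    apply (same_derivative_eq (dom e) (fun t => pt e t cv) _
      (lift_integrand V z) t0 t HI); try assumption.
    + intros s Is.
      assert (L := proj2 Hl s Is).
      apply gS_lightlike_iff in L; [ | exact (ng_t1 U V e He s Is)].
      unfold lift_integrand; rewrite (D _ _ Ex s Is), (D _ _ Ey s Is).
      rewrite (Ex s Is), (Ey s Is).
      change (is_derive (fun t => pt e t cv) s (lagrangian V (pt e s cx)
        (pt e s cy) (velocity (pt e) s cx) (velocity (pt e) s cy))).
      rewrite <- L; apply velocity_derive; [apply He | exact Is].
    + intros s Is.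
      exact (lift_derive U V t0 z s HU HV Hz I0 (Ed s Is) cv).
    + rewrite E0; symmetry; exact (RInt_point t0 (lift_integrand V z)).
  - symmetry; exact (ng_t U V e He t It).
  - exact (Ex t It).
  - exact (Ey t It).
Qed.

Lemma z_curve_extends c d : extends c d -> extends (z_curve c) (z_curve d).
Proof.
  intros H t It; destruct (H t It) as [Id E]; split; [exact Id | ].
  simpl; rewrite E; reflexivity.
Qed.

Lemma z_curve_lift V t0 z : curve_eq (z_curve (lift V t0 z)) z.
Proof.
  split; intros t It; split; try exact It; simpl; [symmetry | ];
    apply pair_Re_Im.
Qed.

Lemma extends_trans {X} (a b c : curve X) :
  extends a b -> extends b c -> extends a c.
Proof.
  intros H1 H2 t It; destruct (H1 t It) as [I1 E1].
  destruct (H2 t I1) as [I2 E2].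
  split; [exact I2 | rewrite E2; exact E1].
Qed.

Lemma initial_normal U V t0 z0 dz0 c :
  open U -> C2_plane U V -> geodesic (gS U V) c ->
  initial_geodesic V t0 z0 dz0 c -> normal_geodesic U V c.
Proof.
  intros HU HV Hc (I0 & E0 & D0).
  apply (geodesic_normal U V c t0); try assumption.
  - exact (E0 ct).
  - exact (D0 ct).
Qed.

(** A geodesic that extends the lift projects to a solution that extends
    [z]. *)
Lemma lift_maximal U V t0 z z0 dz0 :
  open U -> C2_plane U V -> maximal (solution U V) z ->
  initial_z t0 z0 dz0 z -> maximal (geodesic (gS U V)) (lift V t0 z).
Proof.
  intros HU HV [Hz Hmax] H0; assert (I0 := proj1 H0).
  split; [apply lift_null_geodesic; assumption | ].
  intros d Hd Hext.
  assert (Hi := lift_initial U V t0 z z0 dz0 HU HV Hz H0).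
  destruct (Hext t0 I0) as [Id0 Ed0].
  assert (Hn : normal_geodesic U V d).
  { apply (geodesic_normal U V d t0); try assumption.
    - rewrite Ed0; reflexivity.
    - transitivity (velocity (pt (lift V t0 z)) t0 ct);
        [ | exact (proj2 (proj2 Hi) ct)].
      apply Derive_ext_loc; apply filter_imp with (dom z).
      + intros s Is; rewrite (proj2 (Hext s Is)); reflexivity.
      + apply open_interval_locally; [apply Hz | exact I0]. }
  apply (Hmax (z_curve d)); [apply z_curve_solution, Hn | ].
  apply extends_trans with (z_curve (lift V t0 z)).
  - apply z_curve_lift.
  - apply z_curve_extends, Hext.
Qed.

(** Conversely, a solution that extends the projection lifts to a geodesic
    that extends [e]. *)
Lemma z_curve_maximal U V t0 z0 dz0 e :
  open U -> C2_plane U V -> maximal (geodesic (gS U V)) e ->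
  lightlike_geodesic (gS U V) e -> initial_geodesic V t0 z0 dz0 e ->
  maximal (solution U V) (z_curve e).
Proof.
  intros HU HV [He Hmax] Hl Hi.
  assert (Hn := initial_normal U V t0 z0 dz0 e HU HV He Hi).
  destruct Hi as (I0 & E0 & _).
  split; [apply z_curve_solution, Hn | ].
  intros w Hw Hext.
  assert (Iw0 := proj1 (Hext t0 I0)).
  apply (Hmax (lift V t0 w)).
  - apply lift_null_geodesic; assumption.
  - apply (null_geodesic_extends_lift U); try assumption; exact (E0 cv).
Qed.

Theorem null_geodesics_bijection U V t0 z0 dz0 :
  open U -> C2_plane U V ->
  bijection
    (fun z => maximal (solution U V) z /\ initial_z t0 z0 dz0 z)
    (fun c => maximal (geodesic (gS U V)) c /\
              lightlike_geodesic (gS U V) c /\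
              initial_geodesic V t0 z0 dz0 c)
    (lift V t0) /\
  forall z, maximal (solution U V) z -> initial_z t0 z0 dz0 z ->
    same_components z (lift V t0 z).
Proof.
  intros HU HV.
  assert (Hlift : forall z,
    maximal (solution U V) z -> initial_z t0 z0 dz0 z ->
    lightlike_geodesic (gS U V) (lift V t0 z) /\
    normal_geodesic U V (lift V t0 z)).
  { intros z [Hz _] H0.
    assert (L := lift_null_geodesic U V t0 z HU HV Hz (proj1 H0)).
    split; [exact L | ].
    apply (initial_normal U V t0 z0 dz0); try assumption; [apply L | ].
    apply (lift_initial U); assumption. }
  split; [split; [ | split] | ].
  - intros z [Hz H0]; split; [ | split].
    + apply (lift_maximal U V t0 z z0 dz0); assumption.
    + apply Hlift; assumption.
    + apply (lift_initial U); try assumption; apply Hz.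
  - assert (H : forall z w,
      maximal (solution U V) z /\ initial_z t0 z0 dz0 z ->
      maximal (solution U V) w /\ initial_z t0 z0 dz0 w ->
      (extends (lift V t0 z) (lift V t0 w) <-> extends z w)).
    { intros z w [Hz H0] [Hw Hw0]; split; intro H.
      - apply extends_trans with (z_curve (lift V t0 z));
          [apply z_curve_lift | ].
        apply extends_trans with (z_curve (lift V t0 w));
          [ | apply z_curve_lift].
        apply z_curve_extends, H.
      - apply (null_geodesic_extends_lift U); try assumption;
          try (apply Hlift; assumption);
          try apply Hw; try apply Hw0; try apply H0.
        + exact (RInt_point t0 (lift_integrand V z)).
        + apply extends_trans with z; [apply z_curve_lift | exact H]. }
    intros z w Hz Hw; unfold curve_eq.
    rewrite (H z w Hz Hw), (H w z Hw Hz); reflexivity.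
  - intros e (Hmax & Hl & Hi).
    assert (Hn := initial_normal U V t0 z0 dz0 e HU HV (proj1 Hmax) Hi).
    assert (Hz := z_curve_maximal U V t0 z0 dz0 e HU HV Hmax Hl Hi).
    destruct Hi as (I0 & E0 & D0).
    exists (z_curve e).
    split; [split; [exact Hz | split; [exact I0 | split]] | ].
    + simpl; rewrite (E0 cx), (E0 cy); apply pair_Re_Im.
    + apply is_derive_C_iff; split.
      * rewrite <- (D0 cx : _ = Re dz0).
        apply (velocity_derive e cx t0); [apply Hn | exact I0].
      * rewrite <- (D0 cy : _ = Im dz0).
        apply (velocity_derive e cy t0); [apply Hn | exact I0].
    + assert (X : extends e (lift V t0 (z_curve e))).
      { apply (null_geodesic_extends_lift U); try assumption; try apply Hz.
        - exact (E0 cv).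
        - intros t It; split; [exact It | reflexivity]. }
      split; [ | exact X].
      intros t It; split; [exact It | ].
      symmetry; apply (X t It).
  - intros z Hz H0; split; [reflexivity | ].
    intros t It; repeat split.
Qed.

(** * Change of parameter *)

Lemma positive_derive_increasing (I : R -> Prop) (tau m : R -> R) a b :
  open_interval I -> (forall t, I t -> is_derive tau t (m t)) ->
  (forall t, I t -> 0 < m t) -> I a -> I b -> a < b -> tau a < tau b.
Proof.
  intros HI Hd Hm Ia Ib Hab.
  destruct (MVT_interval I tau m a b HI Ia Ib Hd) as (xi & Ixi & E).
  assert (Hp := Rmult_lt_0_compat _ _ (Hm xi Ixi)
    (proj2 (Rlt_0_minus _ _) Hab)); lra.
Qed.

Lemma IVT_on (I : R -> Prop) (u u' : R -> R) a b s :
  open_interval I -> (forall t, I t -> is_derive u t (u' t)) ->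
  I a -> I b -> a < b -> u a <= s <= u b ->
  exists t, a <= t <= b /\ u t = s.
Proof.
  intros HI Hd Ia Ib Hab [H1 H2].
  destruct (Rle_lt_or_eq_dec _ _ H1) as [L1 | E1];
    [ | exists a; split; [lra | exact E1]].
  destruct (Rle_lt_or_eq_dec _ _ H2) as [L2 | E2];
    [ | exists b; split; [lra | symmetry; exact E2]].
  destruct (IVT_interv (fun t => u t - s) a b) as (t & Ht & E).
  - intros t Ht.
    assert (It : I t) by exact (proj2 (proj2 HI) a b t Ia Ib Ht).
    apply continuity_pt_minus.
    + apply continuity_pt_filterlim, (is_derive_continuous u t (u' t)), Hd, It.
    + apply continuity_pt_const; intros ? ?; reflexivity.
  - exact Hab.
  - lra.
  - lra.
  - exists t; split; [exact Ht | lra].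
Qed.

(** The reciprocal difference quotients converge because the inverse is
    itself continuous: it maps the image of a small interval around [t] into
    that interval. *)
Lemma is_derive_inverse (I : R -> Prop) (tau m sigma : R -> R) t :
  open_interval I -> (forall t, I t -> is_derive tau t (m t)) ->
  (forall t, I t -> 0 < m t) -> (forall t, I t -> sigma (tau t) = t) -> I t ->
  is_derive sigma (tau t) (/ m t) /\
  locally (tau t) (fun s => exists t, I t /\ tau t = s).
Proof.
  intros HI Hd Hm Hs It.
  assert (Hloc : forall d, 0 < d -> exists e : posreal,
    forall h, Rabs h < e -> exists k, Rabs k < d /\ I (t + k) /\
      tau (t + k) = tau t + h).
  { intros d d0.
    destruct (proj1 (proj2 HI) t It) as [e He].
    (* half of the smaller radius keeps both end points inside [I] *)
    pose (r := Rmin d e / 2).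
    assert (e0 := cond_pos e).
    assert (Hr : 0 < r /\ r < d /\ r < e)
      by (unfold r, Rmin; destruct (Rle_dec d e); lra).
    assert (Hball : forall k, - r <= k <= r -> I (t + k)).
    { intros k Hk; apply He; change (Rabs (t + k - t) < e).
      replace (t + k - t) with k by ring; apply Rabs_def1; lra. }
    assert (Il : I (t + - r)) by (apply Hball; lra).
    assert (Ir : I (t + r)) by (apply Hball; lra).
    assert (Ll : tau (t + - r) < tau t)
      by (apply (positive_derive_increasing I tau m); auto; lra).
    assert (Lr : tau t < tau (t + r))
      by (apply (positive_derive_increasing I tau m); auto; lra).
    assert (e1 : 0 < Rmin (tau (t + r) - tau t) (tau t - tau (t + - r)))
      by (apply Rmin_glb_lt; lra).
    exists (mkposreal _ e1); intros h Hh; simpl in Hh.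
    apply Rabs_def2 in Hh.
    assert (Hm1 := Rmin_l (tau (t + r) - tau t) (tau t - tau (t + - r))).
    assert (Hm2 := Rmin_r (tau (t + r) - tau t) (tau t - tau (t + - r))).
    destruct (IVT_on I tau m (t + - r) (t + r) (tau t + h))
      as (t' & Ht' & E); try assumption; try lra.
    exists (t' - t); replace (t + (t' - t)) with t' by ring.
    split; [apply Rabs_def1; lra | split; [ | exact E]].
    replace t' with (t + (t' - t)) by ring; apply Hball; lra. }
  assert (M0 := Hm t It).
  split.
  - apply is_derive_Reals; intros eps eps0.
    assert (Dt := proj1 (is_derive_Reals tau t (m t)) (Hd t It)).
    (* the first bound keeps the quotient [q] above [m t / 2], and then
       [|1/q - 1/m| = |q - m| / (q m)] is small by the second *)
    pose (q0 := Rmin (m t / 2) (eps * (m t * m t) / 2)).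
    assert (Hq0 : 0 < q0).
    { apply Rmin_glb_lt; [lra | ].
      assert (P := Rmult_lt_0_compat _ _ eps0 (Rmult_lt_0_compat _ _ M0 M0)).
      lra. }
    destruct (Dt q0 Hq0) as [d Hdt].
    destruct (Hloc d (cond_pos d)) as [e He].
    exists e; intros h h0 Hh; destruct (He h Hh) as (k & Hk & Ik & Ek).
    rewrite <- Ek, !Hs by assumption.
    replace (t + k - t) with k by ring.
    assert (k0 : k <> 0)
      by (intro K; rewrite K, Rplus_0_r in Ek; apply h0; lra).
    specialize (Hdt k k0 Hk).
    replace (tau (t + k) - tau t) with h in Hdt by lra.
    pose (q := h / k); fold q in Hdt.
    assert (Q1 := Rmin_l (m t / 2) (eps * (m t * m t) / 2)).
    assert (Q2 := Rmin_r (m t / 2) (eps * (m t * m t) / 2)).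
    fold q0 in Q1, Q2.
    assert (Hq : m t / 2 < q) by (apply Rabs_def2 in Hdt; lra).
    replace (k / h - / m t) with (- ((q - m t) / (q * m t)))
      by (unfold q; field; repeat split; lra).
    assert (P : 0 < q * m t) by (apply Rmult_lt_0_compat; lra).
    rewrite Rabs_Ropp; unfold Rdiv; rewrite Rabs_mult, Rabs_inv.
    rewrite (Rabs_right (q * m t)) by lra.
    apply (Rmult_lt_reg_r (q * m t)); [exact P | ].
    rewrite Rmult_assoc, Rinv_l, Rmult_1_r by lra.
    apply Rlt_le_trans with q0; [exact Hdt | ].
    apply Rle_trans with (eps * (m t * m t) / 2); [exact Q2 | ].
    replace (eps * (m t * m t) / 2) with (eps * (m t / 2 * m t)) by field.
    apply Rmult_le_compat_l; [lra | ].
    apply Rmult_le_compat_r; lra.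
  - destruct (Hloc 1 Rlt_0_1) as [e He]; exists e; intros s Hs'.
    destruct (He (s - tau t) Hs') as (k & _ & Ik & Ek).
    exists (t + k); split; [exact Ik | rewrite Ek; ring].
Qed.

Definition image (tau : R -> R) (I : R -> Prop) (s : R) : Prop :=
  exists t, I t /\ tau t = s.

Lemma image_open_interval (I : R -> Prop) (tau m sigma : R -> R) :
  open_interval I -> (forall t, I t -> is_derive tau t (m t)) ->
  (forall t, I t -> 0 < m t) -> (forall t, I t -> sigma (tau t) = t) ->
  open_interval (image tau I).
Proof.
  intros HI Hd Hm Hs; split; [ | split].
  - destruct HI as ((t & It) & _); exists (tau t), t; auto.
  - intros s (t & It & E); rewrite <- E.
    exact (proj2 (is_derive_inverse I tau m sigma t HI Hd Hm Hs It)).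
  - intros s s' r (t & It & E) (t' & It' & E') Hr.
    destruct (Rtotal_order t t') as [L | [L | L]].
    + destruct (IVT_on I tau m t t' r HI Hd It It' L) as (x & Hx & Ex);
        [lra | ].
      exists x; split; [exact (proj2 (proj2 HI) t t' x It It' Hx) | exact Ex].
    + exists t; split; [exact It | rewrite L in *; lra].
    + assert (H := positive_derive_increasing I tau m t' t HI Hd Hm It' It L).
      exfalso; lra.
Qed.

Lemma inverse_exists (I : R -> Prop) (tau m : R -> R) :
  open_interval I -> (forall t, I t -> is_derive tau t (m t)) ->
  (forall t, I t -> 0 < m t) ->
  exists sigma, forall t, I t -> sigma (tau t) = t.
Proof.
  intros HI Hd Hm.
  exists (fun s => epsilon (inhabits 0) (fun t => I t /\ tau t = s)).
  intros t It.
  destruct (epsilon_spec (inhabits 0) (fun r => I r /\ tau r = tau t))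
    as [Ir Er]; [exists t; auto | ].
  revert Ir Er; generalize
    (epsilon (inhabits 0) (fun r => I r /\ tau r = tau t)); intros r Ir Er.
  destruct (Rtotal_order r t) as [L | [L | L]]; [ | exact L | ].
  - assert (H := positive_derive_increasing I tau m r t HI Hd Hm Ir It L); lra.
  - assert (H := positive_derive_increasing I tau m t r HI Hd Hm It Ir L); lra.
Qed.

Record time_change (I : R -> Prop) (W W1 tau sigma : R -> R) : Prop := {
  tc_interval : open_interval I;
  tc_tau : forall t, I t -> is_derive tau t (exp (2 * W t));
  tc_inverse : forall t, I t -> sigma (tau t) = t;
  tc_W : forall t, I t -> is_derive W t (W1 t);
  tc_W1 : forall t, I t -> continuous W1 t
}.

Lemma time_change_image I W W1 tau sigma :
  time_change I W W1 tau sigma -> open_interval (image tau I).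
Proof.
  intros [HI Ht Hs _ _].
  apply (image_open_interval I tau (fun t => exp (2 * W t)) sigma); auto.
  intros; apply exp_pos.
Qed.

Lemma is_derive_exp_scal (a : R) (W : R -> R) t (w : R) :
  is_derive W t w ->
  is_derive (fun s => exp (a * W s)) t (a * w * exp (a * W t)).
Proof.
  intro H; rewrite Rmult_comm.
  apply (is_derive_comp_R exp (fun s => a * W s)).
  - apply is_derive_Reals, derivable_pt_lim_exp.
  - exact (is_derive_scal W t a w H).
Qed.

Lemma time_change_sigma I W W1 tau sigma t :
  time_change I W W1 tau sigma -> I t ->
  is_derive sigma (tau t) (exp (- 2 * W t)).
Proof.
  intros [HI Ht Hs _ _] It.
  replace (exp (- 2 * W t)) with (/ exp (2 * W t))
    by (rewrite <- exp_Ropp; f_equal; ring).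
  apply (is_derive_inverse I tau (fun t => exp (2 * W t)) sigma); auto.
  intros; apply exp_pos.
Qed.

Lemma time_change_pull I W W1 tau sigma X :
  time_change I W W1 tau sigma -> C2_on (image tau I) X ->
  C2_on I (fun t => X (tau t)).
Proof.
  intros [HI Ht Hs HW HW1] HX.
  apply (C2_on_comp (image tau I) I X tau HI); [ | exact HX | ].
  - intros t It; exists t; auto.
  - apply (C2_on_intro I tau _ _ HI Ht
      (fun t It => is_derive_exp_scal 2 W t (W1 t) (HW t It))).
    intros t It; apply continuous_mult_R.
    + apply (continuous_mult_R (fun _ => 2));
        [apply continuous_const | exact (HW1 t It)].
    + exact (is_derive_continuous _ t _
        (is_derive_exp_scal 2 W t (W1 t) (HW t It))).
Qed.

(** With respect to [s = tau t] one has [d/ds = exp (- 2 W) d/dt]. *)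
Lemma time_change_push I W W1 tau sigma (X u : R -> R) :
  time_change I W W1 tau sigma -> C2_on I u ->
  (forall t, I t -> X (tau t) = u t) ->
  C2_on (image tau I) X /\
  forall t, I t ->
    Derive X (tau t) = exp (- 2 * W t) * Derive u t /\
    Derive (Derive X) (tau t) = exp (- 2 * W t) * exp (- 2 * W t) *
      (Derive (Derive u) t - 2 * W1 t * Derive u t).
Proof.
  intros Htc Hu E.
  assert (HE := time_change_image I W W1 tau sigma Htc).
  assert (Hmap : forall s, image tau I s -> I (sigma s))
    by (intros s (t & It & <-); rewrite (tc_inverse _ _ _ _ _ Htc t It);
        exact It).
  assert (ds : forall s, image tau I s ->
      is_derive sigma s (exp (- 2 * W (sigma s)))).
  { intros s (t & It & <-); rewrite (tc_inverse _ _ _ _ _ Htc t It).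
    exact (time_change_sigma I W W1 tau sigma t Htc It). }
  assert (ds2 : forall s, image tau I s ->
      is_derive (fun s => exp (- 2 * W (sigma s))) s
        (- 2 * (W1 (sigma s) * exp (- 2 * W (sigma s)))
           * exp (- 2 * W (sigma s)))).
  { intros s Is; apply (is_derive_exp_scal (- 2) (fun s => W (sigma s))).
    apply is_derive_comp_R; [ | exact (ds s Is)].
    apply (tc_W _ _ _ _ _ Htc), Hmap, Is. }
  assert (D := comp_derive2 I (image tau I) u (Derive u) (Derive (Derive u))
    sigma _ _ Hmap (fun t => C2_on_derive I u t Hu)
    (fun t => C2_on_derive2 I u t Hu) ds ds2).
  assert (EX : forall s, image tau I s -> u (sigma s) = X s)
    by (intros s (t & It & <-); rewrite (tc_inverse _ _ _ _ _ Htc t It);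
        symmetry; exact (E t It)).
  assert (DX : forall s, image tau I s -> is_derive X s
      (Derive u (sigma s) * exp (- 2 * W (sigma s)))).
  { intros s Is; apply is_derive_ext_loc with (2 := proj1 (D s Is)).
    exact (filter_imp _ _ EX (open_interval_locally _ s HE Is)). }
  assert (DX2 := fun s Is => proj2 (D s Is)).
  split.
  - apply (C2_on_intro _ X _ _ HE DX DX2).
    intros s Is.
    assert (cs := is_derive_continuous sigma s _ (ds s Is)).
    assert (cq := is_derive_continuous _ s _ (ds2 s Is)).
    assert (cW := continuous_comp sigma W1 s cs
      (tc_W1 _ _ _ _ _ Htc _ (Hmap s Is))).
    assert (cu1 := continuous_comp sigma _ s cs
      (C2_on_continuous1 I u _ Hu (Hmap s Is))).
    assert (cu2 := continuous_comp sigma _ s cs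
      (C2_on_continuous2 I u _ Hu (Hmap s Is))).
    apply continuous_plus_R.
    + exact (continuous_mult_R _ _ s (continuous_mult_R _ _ s cu2 cq) cq).
    + apply (continuous_mult_R (fun s => Derive u (sigma s))); [exact cu1 | ].
      apply continuous_mult_R; [ | exact cq].
      apply (continuous_mult_R (fun _ => - 2)); [apply continuous_const | ].
      exact (continuous_mult_R _ _ s cW cq).
  - intros t It.
    assert (Is : image tau I (tau t)) by (exists t; auto).
    assert (E1 := is_derive_unique _ _ _ (DX _ Is)).
    assert (E2 := is_derive_unique _ _ _
      (Derive2_on _ X _ _ (tau t) HE DX DX2 Is)).
    rewrite (tc_inverse _ _ _ _ _ Htc t It) in E1, E2.
    split; [rewrite E1; ring | ].
    etransitivity; [exact E2 | ].
    rewrite (tc_inverse _ _ _ _ _ Htc t It); ring.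
Qed.

(** * Conformal change of the linearised geodesic equation *)

Lemma part_plus U (h k : R -> R -> R) l x y :
  C1_plane U h -> C1_plane U k -> U (x, y) ->
  part l (fun x y => h x y + k x y) x y = part l h x y + part l k x y.
Proof.
  intros Hh Hk Uxy.
  destruct (Hh x y Uxy) as (hx & hy & _).
  destruct (Hk x y Uxy) as (kx & ky & _).
  destruct l; try (simpl; ring).
  - exact (Derive_plus (fun u => h u y) (fun u => k u y) x hx kx).
  - exact (Derive_plus (h x) (k x) y hy ky).
Qed.

Lemma part_mult U (h k : R -> R -> R) l x y :
  C1_plane U h -> C1_plane U k -> U (x, y) ->
  part l (fun x y => h x y * k x y) x y =
    part l h x y * k x y + h x y * part l k x y.
Proof.
  intros Hh Hk Uxy.
  destruct (Hh x y Uxy) as (hx & hy & _).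
  destruct (Hk x y Uxy) as (kx & ky & _).
  destruct l; try (simpl; ring).
  - exact (Derive_mult (fun u => h u y) (fun u => k u y) x hx kx).
  - exact (Derive_mult (h x) (k x) y hy ky).
Qed.

Lemma part_scal (a : R) (h : R -> R -> R) l x y :
  part l (fun x y => a * h x y) x y = a * part l h x y.
Proof.
  destruct l; try (simpl; ring).
  - exact (Derive_scal (fun u => h u y) a x).
  - exact (Derive_scal (h x) a y).
Qed.

Lemma part_opp (h : R -> R -> R) l x y :
  part l (fun x y => - h x y) x y = - part l h x y.
Proof.
  destruct l; try (simpl; ring).
  - exact (Derive_opp (fun u => h u y) x).
  - exact (Derive_opp (h x) y).
Qed.

Lemma part_const (a : R) l x y : part l (fun _ _ => a) x y = 0.
Proof. destruct l; try reflexivity; exact (Derive_const a _). Qed.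

Lemma part_gS_symbols V l k i j x y :
  part l (gS_symbols V k i j) x y =
  match k, i, j with
  | cv, ct, cx | cv, cx, ct => - part l (dx V) x y
  | cv, ct, cy | cv, cy, ct => - part l (dy V) x y
  | cx, ct, ct => - part l (dx V) x y
  | cy, ct, ct => part l (dy V) x y
  | _, _, _ => 0
  end.
Proof.
  destruct k, i, j; try exact (part_const 0 l x y); try reflexivity;
    exact (part_opp _ l x y).
Qed.

Lemma part_gS_grad f l k x y :
  part l (gS_grad f k) x y =
  match k with
  | cx => - part l (dx f) x y | cy => part l (dy f) x y | _ => 0
  end.
Proof.
  destruct k; [exact (part_const 0 l x y) | exact (part_const 0 l x y)
    | exact (part_opp (dx f) l x y) | reflexivity].
Qed.

Lemma part_conformal_symbols U f V l k i j x y :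
  open U -> C2_plane U f -> C2_plane U V -> U (x, y) ->
  part l (conformal_symbols f V k i j) x y =
  part l (gS_symbols V k i j) x y
  + (delta k i * part l (part j f) x y + delta k j * part l (part i f) x y
     - (part l (gS_plane V i j) x y * gS_grad f k x y
        + gS_plane V i j x y * part l (gS_grad f k) x y)).
Proof.
  intros HU Hf HV Uxy; unfold conformal_symbols.
  assert (D : forall a b, C1_plane U (fun x y => delta a b * part j f x y) /\
      C1_plane U (fun x y => delta a b * part i f x y))
    by (intros a b; split;
        exact (C1_plane_mult U (fun _ _ => delta a b) _ HU
          (C1_plane_const U _ HU) (C1_part U f _ HU Hf))).
  assert (Hp := C1_gS_plane U V i j HU (proj1 HV)).
  assert (Hg := C1_gS_grad U f k HU Hf).
  assert (Hpg := C1_plane_mult U _ _ HU Hp Hg).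
  assert (Hd := C1_plane_plus U _ _ HU (proj1 (D k i)) (proj2 (D k j))).
  assert (Hn := C1_plane_opp U _ HU Hpg).
  assert (E1 := part_plus U (gS_symbols V k i j) _ l x y
    (C1_gS_symbols U V k i j HU HV) (C1_plane_plus U _ _ HU Hd Hn) Uxy).
  assert (E2 := part_plus U _ _ l x y Hd Hn Uxy).
  assert (E3 := part_plus U _ _ l x y (proj1 (D k i)) (proj2 (D k j)) Uxy).
  assert (E4 := part_mult U _ _ l x y Hp Hg Uxy).
  apply (eq_trans E1), f_equal2; [reflexivity | ].
  apply (eq_trans E2); unfold Rminus; apply f_equal2.
  - apply (eq_trans E3), f_equal2; apply part_scal.
  - apply (eq_trans (part_opp _ l x y)); apply f_equal, E4.
Qed.

Definition df (f : R -> R -> R) (x y : R) (X : vec) : R :=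
  dx f x y * X cx + dy f x y * X cy.

(** For vectors [c1], [K], [K1] standing for [c'], [K], [K'], this is the
    derivative of [df K] along [c]. *)
Definition df_dot (f : R -> R -> R) (x y : R) (c1 K K1 : vec) : R :=
  df (dx f) x y K * c1 cx + df (dy f) x y K * c1 cy + df f x y K1.

Definition gS_inner (V : R -> R -> R) (x y : R) (X Y : vec) : R :=
  X cv * Y ct + X ct * Y cv - 2 * V x y * X ct * Y ct
  - X cx * Y cx + X cy * Y cy.

(** Similarly the derivative of [gS_inner c' K] along a geodesic [c]: it is
    the product of [c'] with the covariant derivative of [K], written without
    second derivatives of [c]. *)
Definition gS_inner_dot (V : R -> R -> R) (x y : R) (c1 K K1 : vec) : R :=
  gS_inner V x y c1 K1 - df V x y K * (c1 ct * c1 ct).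

Lemma conformal_geodesic_op f V x y c1 c2 k :
  geodesic_op (conformal_symbols f V) x y c1 c2 k =
  geodesic_op (gS_symbols V) x y c1 c2 k + 2 * df f x y c1 * c1 k
  - gS_inner V x y c1 c1 * gS_grad f k x y.
Proof.
  unfold geodesic_op, conformal_symbols, delta, gS_inner, df, sum4, gS_plane.
  destruct k; simpl; ring.
Qed.

(** The new terms are the variations along [K] of those in
    [conformal_geodesic_op]. *)
Lemma conformal_jacobi_op U f V x y c1 K K1 K2 k :
  open U -> C2_plane U f -> C2_plane U V -> U (x, y) ->
  jacobi_op (conformal_symbols f V) x y c1 K K1 K2 k =
  jacobi_op (gS_symbols V) x y c1 K K1 K2 k
  + 2 * (df_dot f x y c1 K K1 * c1 k + df f x y c1 * K1 k)
  - 2 * gS_inner_dot V x y c1 K K1 * gS_grad f k x y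
  - gS_inner V x y c1 c1 * sum4 (fun l => part l (gS_grad f k) x y * K l).
Proof.
  intros HU Hf HV Uxy.
  assert (E : sum4 (fun i => sum4 (fun j =>
      sum4 (fun l => (delta k i * part l (part j f) x y
         + delta k j * part l (part i f) x y
         - (part l (gS_plane V i j) x y * gS_grad f k x y
            + gS_plane V i j x y * part l (gS_grad f k) x y)) * K l)
       * c1 i * c1 j
      + 2 * ((delta k i * part j f x y + delta k j * part i f x y
         - gS_plane V i j x y * gS_grad f k x y) * c1 i * K1 j))) =
    2 * (df_dot f x y c1 K K1 * c1 k + df f x y c1 * K1 k)
    - 2 * gS_inner_dot V x y c1 K K1 * gS_grad f k x y
    - gS_inner V x y c1 c1 * sum4 (fun l => part l (gS_grad f k) x y * K l)).
  { assert (p0 := part_const 0).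
    assert (P : forall i j : coord, part i (part j f) x y =
      match i, j with
      | cx, cx => dx (dx f) x y | cx, cy => dx (dy f) x y
      | cy, cx => dy (dx f) x y | cy, cy => dy (dy f) x y | _, _ => 0
      end) by (intros [] []; try reflexivity; exact (p0 _ x y)).
    unfold sum4; rewrite !part_gS_plane, !part_gS_grad, !P.
    unfold df_dot, gS_inner_dot, gS_inner, df, delta, gS_plane.
    destruct k; simpl; ring. }
  transitivity (jacobi_op (gS_symbols V) x y c1 K K1 K2 k + (
    2 * (df_dot f x y c1 K K1 * c1 k + df f x y c1 * K1 k)
    - 2 * gS_inner_dot V x y c1 K K1 * gS_grad f k x y
    - gS_inner V x y c1 c1 * sum4 (fun l => part l (gS_grad f k) x y * K l)));
    [ | ring].
  rewrite <- E; unfold jacobi_op; rewrite Rplus_assoc, <- sum4_plus; f_equal.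
  apply sum4_ext; intro i; rewrite <- sum4_plus; apply sum4_ext; intro j.
  unfold sum4; rewrite !(part_conformal_symbols U f V) by assumption.
  unfold conformal_symbols; ring.
Qed.

Lemma jacobi_op_homogeneous G x y q c1 J J1 J2 k :
  jacobi_op G x y (fun i => q * c1 i) J (fun i => q * J1 i)
    (fun i => q * q * J2 i) k = q * q * jacobi_op G x y c1 J J1 J2 k.
Proof. unfold jacobi_op, sum4; ring. Qed.

(** Reparametrising turns [J''] into [K'' - 2 (f o c)' K'] up to a factor;
    this cancels the term [2 (f o c)' K'] produced by the conformal change. *)
Lemma conformal_jacobi_reparam U f V x y q c1 K K1 K2 k :
  open U -> C2_plane U f -> C2_plane U V -> U (x, y) ->
  gS_inner V x y c1 c1 = 0 ->
  jacobi_op (conformal_symbols f V) x y (fun i => q * c1 i) K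
    (fun i => q * K1 i) (fun i => q * q * (K2 i - 2 * df f x y c1 * K1 i)) k =
  q * q * (jacobi_op (gS_symbols V) x y c1 K K1 K2 k
    + 2 * df_dot f x y c1 K K1 * c1 k
    - 2 * gS_inner_dot V x y c1 K K1 * gS_grad f k x y).
Proof.
  intros HU Hf HV Uxy Hn.
  rewrite (jacobi_op_homogeneous (conformal_symbols f V) x y q c1 K K1
    (fun i => K2 i - 2 * df f x y c1 * K1 i)).
  rewrite (conformal_jacobi_op U) by assumption; rewrite Hn.
  unfold jacobi_op; ring.
Qed.

Lemma gS_jacobi_op V x y c1 J J1 J2 :
  c1 ct = 1 ->
  jacobi_op (gS_symbols V) x y c1 J J1 J2 cv =
    J2 cv - 2 * (df (dx V) x y J * c1 cx + df (dy V) x y J * c1 cy)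
    - 2 * (dx V x y * (J1 cx + c1 cx * J1 ct)
           + dy V x y * (J1 cy + c1 cy * J1 ct)) /\
  jacobi_op (gS_symbols V) x y c1 J J1 J2 ct = J2 ct /\
  jacobi_op (gS_symbols V) x y c1 J J1 J2 cx =
    J2 cx - df (dx V) x y J - 2 * dx V x y * J1 ct /\
  jacobi_op (gS_symbols V) x y c1 J J1 J2 cy =
    J2 cy + df (dy V) x y J + 2 * dy V x y * J1 ct.
Proof.
  intro E; unfold jacobi_op, sum4, df; rewrite !part_gS_symbols, E; simpl.
  repeat split; ring.
Qed.

(** * Fields along a null geodesic *)

Definition null_curve (V : R -> R -> R) (c : curve vec) : Prop :=
  forall t, dom c t -> gS_inner V (pt c t cx) (pt c t cy)
    (velocity (pt c) t) (velocity (pt c) t) = 0.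

Lemma inner_gS U V p X Y :
  inner (gS U V) p X Y = gS_inner V (p cx) (p cy) X Y.
Proof. unfold inner, gS_inner, sum4; simpl; ring. Qed.

Lemma inner_conformal f g p X Y :
  inner (conformal f g) p X Y = exp (2 * f p) * inner g p X Y.
Proof. unfold inner, sum4; simpl; ring. Qed.

Lemma is_derive_comp_normal U V h c t :
  open U -> C1_plane U h -> normal_geodesic U V c -> dom c t ->
  is_derive (fun s => h (pt c s cx) (pt c s cy)) t
    (df h (pt c t cx) (pt c t cy) (velocity (pt c) t)).
Proof.
  intros HU Hh Hc It.
  apply (is_derive_comp_plane U h (fun s => pt c s cx) (fun s => pt c s cy));
    try assumption; [exact (ng_region U V c Hc t It) | |];
    apply velocity_derive; (apply Hc || exact It).
Qed.

Lemma is_derive_df U V f c (K : R -> vec) K1 t :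
  open U -> C2_plane U f -> normal_geodesic U V c -> dom c t ->
  (forall i, is_derive (fun s => K s i) t (K1 i)) ->
  is_derive (fun s => df f (pt c s cx) (pt c s cy) (K s)) t
    (df_dot f (pt c t cx) (pt c t cy) (velocity (pt c) t) (K t) K1).
Proof.
  intros HU Hf Hc It HK.
  assert (Dx := is_derive_comp_normal U V (dx f) c t HU
    (proj1 (proj2 Hf)) Hc It).
  assert (Dy := is_derive_comp_normal U V (dy f) c t HU
    (proj2 (proj2 Hf)) Hc It).
  unfold df at 1; evar_last.
  - exact (is_derive_plus_R _ _ t _ _ (is_derive_mult_R _ _ t _ _ Dx (HK cx))
      (is_derive_mult_R _ _ t _ _ Dy (HK cy))).
  - unfold df_dot, df.
    rewrite (mixed_partials_comm U f _ _ HU Hf (ng_region U V c Hc t It)); ring.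
Qed.

Lemma normal_acceleration U V c t :
  normal_geodesic U V c -> dom c t ->
  velocity (velocity (pt c)) t =
    vec4 (2 * df V (pt c t cx) (pt c t cy) (velocity (pt c) t)) 0
      (dx V (pt c t cx) (pt c t cy)) (- dy V (pt c t cx) (pt c t cy)).
Proof.
  intros Hc It; apply functional_extensionality; intros []; simpl.
  - exact (ng_v U V c Hc t It).
  - transitivity (Derive (fun _ => 1) t); [ | apply Derive_const].
    apply Derive_ext_loc; apply filter_imp with (dom c).
    + exact (ng_t1 U V c Hc).
    + exact (open_interval_locally _ t (ng_interval U V c Hc) It).
  - exact (ng_x U V c Hc t It).
  - exact (ng_y U V c Hc t It).
Qed.

Lemma is_derive_gS_inner U V c (K : R -> vec) K1 t :
  open U -> C2_plane U V -> normal_geodesic U V c -> dom c t ->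
  (forall i, is_derive (fun s => K s i) t (K1 i)) ->
  is_derive (fun s => gS_inner V (pt c s cx) (pt c s cy)
      (velocity (pt c) s) (K s)) t
    (gS_inner_dot V (pt c t cx) (pt c t cy) (velocity (pt c) t) (K t) K1).
Proof.
  intros HU HV Hc It HK.
  assert (DV := is_derive_comp_normal U V V c t HU (proj1 HV) Hc It).
  assert (D := fun i => velocity_derive2 c i t (ng_C2 U V c Hc) It).
  assert (E := normal_acceleration U V c t Hc It).
  unfold gS_inner; evar_last.
  - apply is_derive_plus_R;
      [ | exact (is_derive_mult_R _ _ t _ _ (D cy) (HK cy))].
    apply is_derive_minus_R;
      [ | exact (is_derive_mult_R _ _ t _ _ (D cx) (HK cx))].
    apply is_derive_minus_R; [apply is_derive_plus_R | ].
    + exact (is_derive_mult_R _ _ t _ _ (D cv) (HK ct)).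
    + exact (is_derive_mult_R _ _ t _ _ (D ct) (HK cv)).
    + exact (is_derive_mult_R _ _ t _ _ (is_derive_mult_R _ _ t _ _
        (is_derive_scal_R 2 _ t _ DV) (D ct)) (HK ct)).
  - rewrite E; unfold gS_inner_dot, gS_inner, df; simpl.
    rewrite (ng_t1 U V c Hc t It); ring.
Qed.

Definition gS_jacobi_along (V : R -> R -> R) (c : curve vec) (K : R -> vec)
    (t : R) : vec :=
  jacobi_op (gS_symbols V) (pt c t cx) (pt c t cy) (velocity (pt c) t)
    (K t) (velocity K t) (velocity (velocity K) t).

(** The pairing of the Jacobi operator with [c'] is a second derivative: the
    curvature term drops out by antisymmetry.  In coordinates this is the
    equality of the mixed partial derivatives of [V]. *)
Lemma is_derive_gS_inner_dot U V c (K : R -> vec) t :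
  open U -> C2_plane U V -> normal_geodesic U V c ->
  (forall i, C2_on (dom c) (fun s => K s i)) -> dom c t ->
  is_derive (fun s => gS_inner_dot V (pt c s cx) (pt c s cy)
      (velocity (pt c) s) (K s) (velocity K s)) t
    (gS_inner V (pt c t cx) (pt c t cy) (velocity (pt c) t)
      (gS_jacobi_along V c K t)).
Proof.
  intros HU HV Hc HK It.
  assert (D0 : forall i, is_derive (fun s => K s i) t (velocity K t i))
    by (intro i; exact (C2_on_derive _ _ t (HK i) It)).
  assert (D1 : forall i, is_derive (fun s => velocity K s i) t
      (velocity (velocity K) t i))
    by (intro i; exact (C2_on_derive2 _ _ t (HK i) It)).
  assert (DV := is_derive_comp_normal U V V c t HU (proj1 HV) Hc It).
  assert (DdV := is_derive_df U V V c K _ t HU HV Hc It D0).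
  assert (D := fun i => velocity_derive2 c i t (ng_C2 U V c Hc) It).
  assert (E := normal_acceleration U V c t Hc It).
  assert (t1 := ng_t1 U V c Hc t It).
  unfold gS_inner_dot, gS_inner; evar_last.
  - apply is_derive_minus_R;
      [ | exact (is_derive_mult_R _ _ t _ _ DdV
            (is_derive_mult_R _ _ t _ _ (D ct) (D ct)))].
    apply is_derive_plus_R;
      [ | exact (is_derive_mult_R _ _ t _ _ (D cy) (D1 cy))].
    apply is_derive_minus_R;
      [ | exact (is_derive_mult_R _ _ t _ _ (D cx) (D1 cx))].
    apply is_derive_minus_R; [apply is_derive_plus_R | ].
    + exact (is_derive_mult_R _ _ t _ _ (D cv) (D1 ct)).
    + exact (is_derive_mult_R _ _ t _ _ (D ct) (D1 cv)).
    + exact (is_derive_mult_R _ _ t _ _ (is_derive_mult_R _ _ t _ _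
        (is_derive_scal_R 2 _ t _ DV) (D ct)) (D1 ct)).
  - rewrite E; unfold gS_jacobi_along.
    destruct (gS_jacobi_op V (pt c t cx) (pt c t cy) (velocity (pt c) t) (K t)
      (velocity K t) (velocity (velocity K) t) t1) as (Lv & Lt & Lx & Ly).
    rewrite Lv, Lt, Lx, Ly; unfold df_dot, df; simpl; rewrite t1.
    rewrite (mixed_partials_comm U V _ _ HU HV (ng_region U V c Hc t It)); ring.
Qed.

Lemma continuous_df U V h c (X : R -> vec) t :
  C1_plane U h -> normal_geodesic U V c -> dom c t ->
  (forall i, continuous (fun s => X s i) t) ->
  continuous (fun s => df h (pt c s cx) (pt c s cy) (X s)) t.
Proof.
  intros Hh Hc It HX.
  assert (c0 := fun k => C2_on_continuous _ _ t (ng_C2 U V c Hc k) It).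
  destruct (Hh _ _ (ng_region U V c Hc t It)) as (_ & _ & hx & hy).
  exact (continuous_plus_R _ _ t
    (continuous_mult_R _ _ t
      (continuous_comp_plane (dx h) _ _ t hx (c0 cx) (c0 cy)) (HX cx))
    (continuous_mult_R _ _ t
      (continuous_comp_plane (dy h) _ _ t hy (c0 cx) (c0 cy)) (HX cy))).
Qed.

(** * Tangential fields *)

Definition third_derivative (V : R -> R -> R) (x y : R) (c1 c2 : vec) : vec :=
  vec4 (2 * df_dot V x y c1 c1 c2) 0 (df (dx V) x y c1) (- df (dy V) x y c1).

Lemma normal_third_derivative U V c t i :
  open U -> C2_plane U V -> normal_geodesic U V c -> dom c t ->
  is_derive (fun s => velocity (velocity (pt c)) s i) t
    (third_derivative V (pt c t cx) (pt c t cy) (velocity (pt c) t)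
      (velocity (velocity (pt c)) t) i).
Proof.
  intros HU HV Hc It.
  assert (D := fun k => velocity_derive2 c k t (ng_C2 U V c Hc) It).
  apply is_derive_ext_loc with (fun s =>
    vec4 (2 * df V (pt c s cx) (pt c s cy) (velocity (pt c) s)) 0
      (dx V (pt c s cx) (pt c s cy)) (- dy V (pt c s cx) (pt c s cy)) i).
  - apply filter_imp with (dom c).
    + intros s Is; rewrite (normal_acceleration U V c s Hc Is); reflexivity.
    + exact (open_interval_locally _ t (ng_interval U V c Hc) It).
  - destruct i; simpl.
    + apply is_derive_scal_R, (is_derive_df U V); assumption.
    + apply (is_derive_const 0).
    + apply (is_derive_comp_normal U V); try assumption; apply HV.
    + apply (is_derive_opp (fun s => dy V (pt c s cx) (pt c s cy))).
      apply (is_derive_comp_normal U V); try assumption; apply HV.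
Qed.

Lemma normal_velocity_C2 U V c i :
  open U -> C2_plane U V -> normal_geodesic U V c ->
  C2_on (dom c) (fun t => velocity (pt c) t i).
Proof.
  intros HU HV Hc.
  apply (C2_on_intro (dom c) _ _ _ (ng_interval U V c Hc)
    (fun t It => velocity_derive2 c i t (ng_C2 U V c Hc) It)
    (fun t It => normal_third_derivative U V c t i HU HV Hc It)).
  intros t It.
  assert (c1 := fun k => C2_on_continuous1 _ _ t (ng_C2 U V c Hc k) It
    : continuous (fun s => velocity (pt c) s k) t).
  assert (c2 := fun k => C2_on_continuous2 _ _ t (ng_C2 U V c Hc k) It
    : continuous (fun s => velocity (velocity (pt c)) s k) t).
  assert (cd := fun h Hh X HX => continuous_df U V h c X t Hh Hc It HX).
  destruct HV as (HV & HVx & HVy); destruct i; unfold third_derivative; simpl.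
  - apply (continuous_mult_R (fun _ => 2)); [apply continuous_const | ].
    unfold df_dot; apply continuous_plus_R; [ | exact (cd V HV _ c2)].
    exact (continuous_plus_R _ _ t
      (continuous_mult_R _ _ t (cd _ HVx _ c1) (c1 cx))
      (continuous_mult_R _ _ t (cd _ HVy _ c1) (c1 cy))).
  - apply continuous_const.
  - exact (cd _ HVx _ c1).
  - apply (continuous_opp (fun s => df (dy V) _ _ _)), (cd _ HVy _ c1).
Qed.

Lemma jacobi_op_tangential G x y c1 c2 c3 J J1 J2 phi phi1 phi2 k :
  jacobi_op G x y c1 (fun i => J i + phi * c1 i)
    (fun i => J1 i + (phi1 * c1 i + phi * c2 i))
    (fun i => J2 i + (phi2 * c1 i + 2 * phi1 * c2 i + phi * c3 i)) k =
  jacobi_op G x y c1 J J1 J2 k + phi * jacobi_op G x y c1 c1 c2 c3 k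
  + 2 * phi1 * geodesic_op G x y c1 c2 k + phi2 * c1 k.
Proof. unfold jacobi_op, geodesic_op, sum4; ring. Qed.

(** This is the derivative of the geodesic equation along the geodesic. *)
Lemma velocity_jacobi U V c t k :
  normal_geodesic U V c -> dom c t ->
  jacobi_op (gS_symbols V) (pt c t cx) (pt c t cy) (velocity (pt c) t)
    (velocity (pt c) t) (velocity (velocity (pt c)) t)
    (third_derivative V (pt c t cx) (pt c t cy) (velocity (pt c) t)
       (velocity (velocity (pt c)) t)) k = 0.
Proof.
  intros Hc It; rewrite (normal_acceleration U V c t Hc It).
  destruct (gS_jacobi_op V (pt c t cx) (pt c t cy) (velocity (pt c) t)
    (velocity (pt c) t)
    (vec4 (2 * df V (pt c t cx) (pt c t cy) (velocity (pt c) t)) 0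
      (dx V (pt c t cx) (pt c t cy)) (- dy V (pt c t cx) (pt c t cy)))
    (third_derivative V (pt c t cx) (pt c t cy) (velocity (pt c) t)
      (vec4 (2 * df V (pt c t cx) (pt c t cy) (velocity (pt c) t)) 0
        (dx V (pt c t cx) (pt c t cy)) (- dy V (pt c t cx) (pt c t cy))))
    (ng_t1 U V c Hc t It)) as (Lv & Lt & Lx & Ly).
  destruct k; [rewrite Lv | rewrite Lt | rewrite Lx | rewrite Ly];
    unfold third_derivative, df_dot, df; simpl; ring.
Qed.

Lemma normal_geodesic_op U V c t k :
  normal_geodesic U V c -> dom c t ->
  geodesic_op (gS_symbols V) (pt c t cx) (pt c t cy) (velocity (pt c) t)
    (velocity (velocity (pt c)) t) k = 0.
Proof.
  intros Hc It; rewrite (normal_acceleration U V c t Hc It).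
  destruct (gS_geodesic_op V (pt c t cx) (pt c t cy) (velocity (pt c) t)
    (vec4 (2 * df V (pt c t cx) (pt c t cy) (velocity (pt c) t)) 0
      (dx V (pt c t cx) (pt c t cy)) (- dy V (pt c t cx) (pt c t cy))))
    as (Ev & Et & Ex & Ey).
  destruct k; [rewrite Ev | rewrite Et | rewrite Ex | rewrite Ey];
    rewrite ?(ng_t1 U V c Hc t It); unfold df; simpl; ring.
Qed.

Definition tangential_change (c : curve vec) (J K : R -> vec) (phi : R -> R)
    : Prop :=
  forall t, dom c t -> forall k, K t k = J t k + phi t * velocity (pt c) t k.

(** The field [phi c'] contributes only [phi'' c'], since [c'] is parallel and
    itself a Jacobi field. *)
Lemma tangential_derive U V c J K (phi phi1 phi2 : R -> R) :
  open U -> C2_plane U V -> normal_geodesic U V c ->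
  (forall k, C2_on (dom c) (fun t => J t k)) ->
  (forall t, dom c t -> is_derive phi t (phi1 t)) ->
  (forall t, dom c t -> is_derive phi1 t (phi2 t)) ->
  (forall t, dom c t -> continuous phi2 t) ->
  tangential_change c J K phi ->
  (forall k, C2_on (dom c) (fun t => K t k)) /\
  forall t, dom c t -> forall k,
    velocity K t k = velocity J t k + (phi1 t * velocity (pt c) t k
      + phi t * velocity (velocity (pt c)) t k) /\
    gS_jacobi_along V c K t k =
      gS_jacobi_along V c J t k + phi2 t * velocity (pt c) t k.
Proof.
  intros HU HV Hc HJ Hphi Hphi1 Hphi2 HK.
  assert (HI := ng_interval U V c Hc).
  assert (E : forall k t, dom c t ->
      J t k + phi t * velocity (pt c) t k = K t k)
    by (intros k t It; symmetry; exact (HK t It k)).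
  assert (Cphi := C2_on_intro _ _ _ _ HI Hphi Hphi1 Hphi2).
  assert (D1 : forall k t, dom c t -> is_derive (fun t => K t k) t
      (velocity J t k + (phi1 t * velocity (pt c) t k
        + phi t * velocity (velocity (pt c)) t k))).
  { intros k t It.
    apply is_derive_ext_loc with (fun t => J t k + phi t * velocity (pt c) t k).
    - exact (filter_imp _ _ (E k) (open_interval_locally _ t HI It)).
    - apply is_derive_plus_R; [exact (C2_on_derive _ _ t (HJ k) It) | ].
      apply is_derive_mult_R; [exact (Hphi t It) | ].
      apply velocity_derive2; [apply Hc | exact It]. }
  assert (D2 : forall k t, dom c t -> is_derive (fun t => velocity J t k
      + (phi1 t * velocity (pt c) t k
         + phi t * velocity (velocity (pt c)) t k)) t
      (velocity (velocity J) t k + (phi2 t * velocity (pt c) t k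
        + 2 * phi1 t * velocity (velocity (pt c)) t k
        + phi t * third_derivative V (pt c t cx) (pt c t cy) (velocity (pt c) t)
            (velocity (velocity (pt c)) t) k))).
  { intros k t It.
    assert (DJ : is_derive (fun t => velocity J t k) t
        (velocity (velocity J) t k)) by exact (C2_on_derive2 _ _ t (HJ k) It).
    assert (Dc := velocity_derive2 c k t (ng_C2 U V c Hc) It).
    assert (Dc2 := normal_third_derivative U V c t k HU HV Hc It).
    evar_last.
    - exact (is_derive_plus_R _ _ t _ _ DJ (is_derive_plus_R _ _ t _ _
        (is_derive_mult_R _ _ t _ _ (Hphi1 t It) Dc)
        (is_derive_mult_R _ _ t _ _ (Hphi t It) Dc2))).
    - cbv beta; ring. }
  split.
  - intro k; apply (C2_on_ext _ _ _ HI (E k)).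
    apply C2_on_plus; [exact HI | apply HJ | ].
    apply C2_on_mult; [exact HI | exact Cphi | ].
    apply (normal_velocity_C2 U V); assumption.
  - intros t It k; split; [exact (is_derive_unique _ _ _ (D1 k t It)) | ].
    unfold gS_jacobi_along.
    replace (K t) with (fun i => J t i + phi t * velocity (pt c) t i)
      by (apply functional_extensionality; intro i; exact (E i t It)).
    replace (velocity K t) with (fun i => velocity J t i
        + (phi1 t * velocity (pt c) t i
           + phi t * velocity (velocity (pt c)) t i))
      by (apply functional_extensionality; intro i; symmetry;
          exact (is_derive_unique _ _ _ (D1 i t It))).
    replace (velocity (velocity K) t) with (fun i => velocity (velocity J) t i
        + (phi2 t * velocity (pt c) t i
           + 2 * phi1 t * velocity (velocity (pt c)) t i
           + phi t * third_derivative V (pt c t cx) (pt c t cy)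
               (velocity (pt c) t) (velocity (velocity (pt c)) t) i))
      by (apply functional_extensionality; intro i; symmetry;
          exact (is_derive_unique _ _ _
            (Derive2_on _ _ _ _ t HI (D1 i) (D2 i) It))).
    rewrite jacobi_op_tangential, (velocity_jacobi U), (normal_geodesic_op U)
      by assumption; ring.
Qed.

(** * The reparametrised geodesic *)

Definition conformal_gS (U : R * R -> Prop) (V f : R -> R -> R) : metric :=
  conformal (on_R4 f) (gS U V).

Definition reparam (c : curve vec) (tau sigma : R -> R) : curve vec :=
  Curve (image tau (dom c)) (fun s => pt c (sigma s)).

Definition log_factor (f : R -> R -> R) (c : curve vec) (t : R) : R :=
  f (pt c t cx) (pt c t cy).

Definition log_factor_dot (f : R -> R -> R) (c : curve vec) (t : R) : R :=
  df f (pt c t cx) (pt c t cy) (velocity (pt c) t).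

Definition conformal_time (f : R -> R -> R) (c : curve vec)
    (tau sigma : R -> R) : Prop :=
  time_change (dom c) (log_factor f c) (log_factor_dot f c) tau sigma.

Lemma conf_time_change U V f c t0 :
  open U -> C2_plane U f -> normal_geodesic U V c -> dom c t0 ->
  exists sigma, conformal_time f c (conf_time (on_R4 f) (pt c) t0) sigma.
Proof.
  intros HU Hf Hc I0.
  assert (HI := ng_interval U V c Hc).
  assert (HW : forall t, dom c t ->
      is_derive (log_factor f c) t (log_factor_dot f c t))
    by (intros t It; apply (is_derive_comp_normal U V); try assumption;
        apply Hf).
  assert (Htau : forall t, dom c t ->
      is_derive (conf_time (on_R4 f) (pt c) t0) t (exp (2 * log_factor f c t))).
  { intros t It.
    apply (is_derive_RInt_interval (dom c)
      (fun r => exp (2 * on_R4 f (pt c r)))); try assumption.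
    intros s Is; exact (is_derive_continuous _ s _
      (is_derive_exp_scal 2 (log_factor f c) s _ (HW s Is))). }
  destruct (inverse_exists (dom c) _ _ HI Htau (fun t _ => exp_pos _))
    as [sigma Hs].
  exists sigma; split; try assumption.
  intros t It; apply (continuous_df U V); try assumption; [apply Hf | ].
  intro k; exact (C2_on_continuous1 _ _ t (ng_C2 U V c Hc k) It).
Qed.

Lemma time_change_vec I W W1 tau sigma (X u : R -> vec) :
  time_change I W W1 tau sigma -> (forall k, C2_on I (fun t => u t k)) ->
  (forall t, I t -> forall k, X (tau t) k = u t k) ->
  (forall k, C2_on (image tau I) (fun s => X s k)) /\
  forall t, I t ->
    velocity X (tau t) = (fun k => exp (- 2 * W t) * velocity u t k) /\
    velocity (velocity X) (tau t) =
      (fun k => exp (- 2 * W t) * exp (- 2 * W t) *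
        (velocity (velocity u) t k - 2 * W1 t * velocity u t k)).
Proof.
  intros Htc Hu E.
  assert (P := fun k => time_change_push I W W1 tau sigma
    (fun s => X s k) (fun t => u t k) Htc (Hu k) (fun t It => E t It k)).
  split; [intro k; apply (P k) | ].
  intros t It; split; apply functional_extensionality; intro k;
    apply (proj2 (P k) t It).
Qed.

Lemma reparam_derive U V f c tau sigma :
  normal_geodesic U V c -> conformal_time f c tau sigma ->
  (forall k, C2_on (image tau (dom c)) (fun s => pt (reparam c tau sigma) s k))
  /\ forall t, dom c t ->
    pt (reparam c tau sigma) (tau t) = pt c t /\
    velocity (pt (reparam c tau sigma)) (tau t) =
      (fun k => exp (- 2 * log_factor f c t) * velocity (pt c) t k) /\
    velocity (velocity (pt (reparam c tau sigma))) (tau t) =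
      (fun k => exp (- 2 * log_factor f c t) * exp (- 2 * log_factor f c t) *
        (velocity (velocity (pt c)) t k
         - 2 * log_factor_dot f c t * velocity (pt c) t k)).
Proof.
  intros Hc Htc.
  assert (E : forall t, dom c t -> pt (reparam c tau sigma) (tau t) = pt c t)
    by (intros t It; simpl; rewrite (tc_inverse _ _ _ _ _ Htc t It);
        reflexivity).
  destruct (time_change_vec (dom c) _ _ tau sigma
    (pt (reparam c tau sigma)) (pt c) Htc (ng_C2 U V c Hc)) as [C2 D].
  - intros t It k; rewrite E by exact It; reflexivity.
  - split; [exact C2 | ]; intros t It; split; [exact (E t It) | exact (D t It)].
Qed.

(** The conformal change adds [2 W' c'] to the geodesic equation of a null
    curve, with [W = f o c]; the change of parameter subtracts it again. *)
Theorem reparam_null_geodesic U V f c tau sigma :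
  open U -> C2_plane U V -> C2_plane U f ->
  normal_geodesic U V c -> null_curve V c -> conformal_time f c tau sigma ->
  lightlike_geodesic (conformal_gS U V f) (reparam c tau sigma).
Proof.
  intros HU HV Hf Hc Hn Htc.
  destruct (reparam_derive U V f c tau sigma Hc Htc) as [C2 D].
  split.
  - apply (geodesic_iff U _ _ _ (conformal_plane_symbols U f V HU Hf HV)).
    split; [exact (time_change_image _ _ _ _ _ Htc) | split; [exact C2 | ]].
    intros s (t & It & <-); destruct (D t It) as (E0 & E1 & E2).
    rewrite E0, E1, E2; split; [exact (ng_region U V c Hc t It) | ].
    intro k; assert (G := normal_geodesic_op U V c t k Hc It).
    rewrite conformal_geodesic_op.
    assert (N := Hn t It); unfold gS_inner in *; unfold log_factor_dot.
    generalize (exp (- 2 * log_factor f c t)); intro q.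
    set (x := pt c t cx) in *; set (y := pt c t cy) in *.
    set (c1 := velocity (pt c) t) in *.
    set (c2 := velocity (velocity (pt c)) t) in *.
    transitivity (q * q * geodesic_op (gS_symbols V) x y c1 c2 k
      - q * q * (c1 cv * c1 ct + c1 ct * c1 cv - 2 * V x y * c1 ct * c1 ct
          - c1 cx * c1 cx + c1 cy * c1 cy) * gS_grad f k x y).
    + unfold geodesic_op, df, sum4; ring.
    + rewrite G, N; ring.
  - intros s (t & It & <-); destruct (D t It) as (E0 & E1 & _).
    rewrite E0, E1; split.
    + exists ct; rewrite (ng_t1 U V c Hc t It), Rmult_1_r.
      apply Rgt_not_eq, exp_pos.
    + unfold conformal_gS; rewrite inner_conformal, inner_gS.
      assert (N := Hn t It); unfold gS_inner in *.
      generalize (exp (- 2 * log_factor f c t)); intro q.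
      match type of N with ?n = 0 =>
        transitivity (exp (2 * on_R4 f (pt c t)) * (q * q) * n); [ring | ]
      end.
      rewrite N; ring.
Qed.

(** The Jacobi equation of the conformal metric, multiplied by [exp (4 W)] and
    written in the parameter [t] of the original geodesic. *)
Definition conformal_jacobi_along (V f : R -> R -> R) (c : curve vec)
    (K : R -> vec) (t : R) : vec := fun k =>
  gS_jacobi_along V c K t k
  + 2 * df_dot f (pt c t cx) (pt c t cy) (velocity (pt c) t) (K t)
      (velocity K t) * velocity (pt c) t k
  - 2 * gS_inner_dot V (pt c t cx) (pt c t cy) (velocity (pt c) t) (K t)
      (velocity K t) * gS_grad f k (pt c t cx) (pt c t cy).

Lemma gS_jacobi_iff U V c J :
  open U -> C2_plane U V -> geodesic (gS U V) c ->
  jacobi (gS U V) c J <->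
  (forall k, C2_on (dom c) (fun t => J t k)) /\
  forall t, dom c t -> forall k, gS_jacobi_along V c J t k = 0.
Proof.
  intros HU HV Hc; unfold jacobi.
  assert (E : (forall k, C2_on (dom c) (fun t => J t k)) ->
      forall t, dom c t -> forall k, _)
    by exact (fun HJ t It k => jacobi_equation_linearised U _ _ c J t k HU
          (gS_plane_symbols U V HU HV) Hc HJ It).
  split; intros [HJ H]; (split; [exact HJ | ]); intros t It k.
  - exact (eq_trans (eq_sym (E HJ t It k)) (H t It k)).
  - exact (eq_trans (E HJ t It k) (H t It k)).
Qed.

Lemma conformal_jacobi_iff U V f c tau sigma X :
  open U -> C2_plane U V -> C2_plane U f ->
  normal_geodesic U V c -> null_curve V c -> conformal_time f c tau sigma ->
  jacobi (conformal_gS U V f) (reparam c tau sigma) X <->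
  (forall k, C2_on (dom c) (fun t => X (tau t) k)) /\
  forall t, dom c t -> forall k,
    conformal_jacobi_along V f c (fun t => X (tau t)) t k = 0.
Proof.
  intros HU HV Hf Hc Hn Htc.
  assert (Hg := reparam_null_geodesic U V f c tau sigma HU HV Hf Hc Hn Htc).
  destruct (reparam_derive U V f c tau sigma Hc Htc) as [_ D].
  assert (C2_iff : (forall k, C2_on (image tau (dom c)) (fun s => X s k)) <->
      (forall k, C2_on (dom c) (fun t => X (tau t) k))).
  { split; intros H k.
    - exact (time_change_pull _ _ _ tau sigma (fun s => X s k) Htc (H k)).
    - apply (time_change_vec _ _ _ tau sigma X (fun t => X (tau t)) Htc H).
      reflexivity. }
  assert (E : (forall k, C2_on (dom c) (fun t => X (tau t) k)) ->
      forall t, dom c t -> forall k,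
      covD (conformal_gS U V f) (pt (reparam c tau sigma))
        (covD (conformal_gS U V f) (pt (reparam c tau sigma)) X) (tau t) k +
      curvature (conformal_gS U V f) (pt (reparam c tau sigma) (tau t))
        (X (tau t)) (velocity (pt (reparam c tau sigma)) (tau t))
        (velocity (pt (reparam c tau sigma)) (tau t)) k =
      exp (- 2 * log_factor f c t) * exp (- 2 * log_factor f c t) *
        conformal_jacobi_along V f c (fun t => X (tau t)) t k).
  { intros HX t It k.
    assert (Is : image tau (dom c) (tau t)) by (exists t; auto).
    destruct (time_change_vec _ _ _ tau sigma X (fun t => X (tau t)) Htc HX)
      as [_ DX]; [reflexivity | ].
    destruct (D t It) as (E0 & E1 & _); destruct (DX t It) as [X1 X2].
    rewrite (jacobi_equation_linearised U (conformal_gS U V f) _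
      (reparam c tau sigma) X (tau t) k HU
      (conformal_plane_symbols U f V HU Hf HV) (proj1 Hg) (proj2 C2_iff HX) Is).
    rewrite E0, E1, X1, X2.
    exact (conformal_jacobi_reparam U f V _ _ _ _ _ _ _ k HU Hf HV
      (ng_region U V c Hc t It) (Hn t It)). }
  unfold jacobi; split; intros [HX H].
  - assert (HK := proj1 C2_iff HX); split; [exact HK | ].
    intros t It k; specialize (E HK t It k).
    rewrite (H (tau t) (ex_intro _ t (conj It eq_refl)) k) in E.
    assert (q := exp_pos (- 2 * log_factor f c t)).
    symmetry in E; apply Rmult_integral in E; destruct E as [E | E];
      [ | exact E].
    apply Rmult_integral in E; destruct E; lra.
  - split; [exact (proj2 C2_iff HX) | ].
    intros s (t & It & <-) k; rewrite E by assumption.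
    rewrite (H t It k); ring.
Qed.

(** * Linear correspondences *)

Definition lin (a : R) (J J' : R -> vec) : R -> vec :=
  fun t k => a * J t k + J' t k.

Definition combination (n : nat) (r : nat -> R) (B : nat -> R -> vec)
    : R -> vec := fun t k => sum_n_m (fun i => r i * B i t k) 1 n.

Definition vanishes_on (D : R -> Prop) (J : R -> vec) : Prop :=
  forall t k, D t -> J t k = 0.

Definition is_basis (P : (R -> vec) -> Prop) (D : R -> Prop) (n : nat)
    (B : nat -> R -> vec) : Prop :=
  (forall i, (1 <= i <= n)%nat -> P (B i)) /\
  (forall r : nat -> R,
     (forall t k, D t -> sum_n_m (fun i => r i * B i t k) 1 n = 0) ->
     forall i, (1 <= i <= n)%nat -> r i = 0) /\
  (forall J, P J ->
     exists r : nat -> R, forall t k, D t ->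
       J t k = sum_n_m (fun i => r i * B i t k) 1 n).

(** A linear relation between two spaces of fields, which is an isomorphism
    once fields are identified when they agree on the domains. *)
Record correspondence (P Q : (R -> vec) -> Prop) (D E : R -> Prop)
    (Rel : (R -> vec) -> (R -> vec) -> Prop) : Prop := {
  corr_left : forall J X, Rel J X -> P J;
  corr_right : forall J X, Rel J X -> Q X;
  corr_zero : Rel (fun _ _ => 0) (fun _ _ => 0);
  corr_lin : forall a J J' X X',
    Rel J X -> Rel J' X' -> Rel (lin a J J') (lin a X X');
  corr_total : forall J, P J -> exists X, Rel J X;
  corr_onto : forall X, Q X -> exists J, Rel J X;
  corr_zero_right : forall J X, Rel J X -> vanishes_on D J -> vanishes_on E X;
  corr_zero_left : forall J X, Rel J X -> vanishes_on E X -> vanishes_on D J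
}.

Lemma correspondence_sym P Q D E Rel :
  correspondence P Q D E Rel -> correspondence Q P E D (fun X J => Rel J X).
Proof. intros []; split; eauto. Qed.

Lemma combination_S n r B :
  combination (S n) r B = lin (r (S n)) (B (S n)) (combination n r B).
Proof.
  apply functional_extensionality; intro t.
  apply functional_extensionality; intro k.
  unfold combination, lin; rewrite sum_n_Sm by lia.
  unfold plus; simpl; ring.
Qed.

Lemma correspondence_combination P Q D E Rel n r B X :
  correspondence P Q D E Rel ->
  (forall i, (1 <= i <= n)%nat -> Rel (B i) (X i)) ->
  Rel (combination n r B) (combination n r X).
Proof.
  intro HS; induction n as [ | n IH]; intro H.
  - assert (Z : forall B, combination 0 r B = fun _ _ => 0).
    { intro B'; apply functional_extensionality; intro t.
      apply functional_extensionality; intro k.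
      unfold combination; rewrite sum_n_m_zero by lia; reflexivity. }
    rewrite !Z; exact (corr_zero _ _ _ _ _ HS).
  - rewrite !combination_S; apply (corr_lin _ _ _ _ _ HS).
    + apply H; lia.
    + apply IH; intros i Hi; apply H; lia.
Qed.

(** Freeness holds because a vanishing combination on one side corresponds to
    the same combination on the other. For spanning, [Y] minus the
    combination that represents its partner [J] corresponds to a field that
    vanishes. *)
Lemma correspondence_basis P Q D E Rel n :
  correspondence P Q D E Rel ->
  (exists B, is_basis P D n B) -> exists X, is_basis Q E n X.
Proof.
  intros HS (B & HB & Hfree & Hspan).
  assert (H : forall i, exists X, (1 <= i <= n)%nat -> Rel (B i) X).
  { intro i; destruct (classic (1 <= i <= n)%nat) as [Hi | Hi].
    - destruct (corr_total _ _ _ _ _ HS (B i) (HB i Hi)) as [X HX]; eauto.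
    - exists (B i); intro; contradiction. }
  pose (X := fun i => proj1_sig (constructive_indefinite_description _ (H i))).
  assert (HX : forall i, (1 <= i <= n)%nat -> Rel (B i) (X i))
    by (intro i;
        exact (proj2_sig (constructive_indefinite_description _ (H i)))).
  exists X; split; [ | split].
  - intros i Hi; exact (corr_right _ _ _ _ _ HS _ _ (HX i Hi)).
  - intros r Hr; apply Hfree.
    exact (corr_zero_left _ _ _ _ _ HS _ _
      (correspondence_combination P Q D E Rel n r B X HS HX) Hr).
  - intros Y HY.
    destruct (corr_onto _ _ _ _ _ HS Y HY) as [J HJ].
    destruct (Hspan J (corr_left _ _ _ _ _ HS _ _ HJ)) as [r Hr].
    exists r; intros t k Et.
    assert (Hdiff := corr_lin _ _ _ _ _ HS (- 1) _ _ _ _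
      (correspondence_combination P Q D E Rel n r B X HS HX) HJ).
    assert (Z := corr_zero_right _ _ _ _ _ HS _ _ Hdiff).
    assert (V : vanishes_on E (lin (- 1) (combination n r X) Y)).
    { apply Z; intros u i Du; unfold lin, combination; rewrite Hr by exact Du.
      ring. }
    specialize (V t k Et); unfold lin, combination in V; lra.
Qed.

Lemma correspondence_nontrivial P Q D E Rel :
  correspondence P Q D E Rel ->
  (exists J, P J /\ exists t k, D t /\ J t k <> 0) ->
  exists X, Q X /\ exists t k, E t /\ X t k <> 0.
Proof.
  intros HS (J & HJ & t & k & Dt & N).
  destruct (corr_total _ _ _ _ _ HS J HJ) as [X HX].
  exists X; split; [exact (corr_right _ _ _ _ _ HS _ _ HX) | ].
  apply NNPP; intro Habs; apply N.
  apply (corr_zero_left _ _ _ _ _ HS J X HX); [ | exact Dt].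
  intros s i Es; apply NNPP; intro Ns; apply Habs; eauto.
Qed.

(** * Linear combinations of Jacobi fields *)

Lemma lin_derive I (a : R) (J J' : R -> vec) :
  open_interval I ->
  (forall k, C2_on I (fun t => J t k)) ->
  (forall k, C2_on I (fun t => J' t k)) ->
  (forall k, C2_on I (fun t => lin a J J' t k)) /\
  forall t, I t ->
    velocity (lin a J J') t = (fun k => a * velocity J t k + velocity J' t k) /\
    velocity (velocity (lin a J J')) t =
      (fun k => a * velocity (velocity J) t k + velocity (velocity J') t k).
Proof.
  intros HI HJ HJ'.
  assert (D1 : forall k t, I t -> is_derive (fun t => lin a J J' t k) t
      (a * velocity J t k + velocity J' t k)).
  { intros k t It; apply is_derive_plus_R.
    - apply is_derive_scal_R; exact (C2_on_derive _ _ t (HJ k) It).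
    - exact (C2_on_derive _ _ t (HJ' k) It). }
  assert (D2 : forall k t, I t ->
      is_derive (fun t => a * velocity J t k + velocity J' t k) t
      (a * velocity (velocity J) t k + velocity (velocity J') t k)).
  { intros k t It; apply is_derive_plus_R.
    - apply is_derive_scal_R; exact (C2_on_derive2 _ _ t (HJ k) It).
    - exact (C2_on_derive2 _ _ t (HJ' k) It). }
  split.
  - intro k; apply (C2_on_intro I _ _ _ HI (D1 k) (D2 k)).
    intros t It; apply continuous_plus_R.
    + apply (continuous_mult_R (fun _ => a)); [apply continuous_const | ].
      exact (C2_on_continuous2 _ _ t (HJ k) It).
    + exact (C2_on_continuous2 _ _ t (HJ' k) It).
  - intros t It; split; apply functional_extensionality; intro k.
    + exact (is_derive_unique _ _ _ (D1 k t It)).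
    + exact (is_derive_unique _ _ _
        (Derive2_on I _ _ _ t HI (D1 k) (D2 k) It)).
Qed.

Lemma zero_field_velocity : velocity (fun _ _ => 0) = fun _ _ => 0.
Proof.
  apply functional_extensionality; intro t.
  apply functional_extensionality; intro k; exact (Derive_const 0 t).
Qed.

Lemma gS_jacobi_along_lin V c a J J' t :
  open_interval (dom c) ->
  (forall k, C2_on (dom c) (fun t => J t k)) ->
  (forall k, C2_on (dom c) (fun t => J' t k)) -> dom c t ->
  forall k, gS_jacobi_along V c (lin a J J') t k =
    a * gS_jacobi_along V c J t k + gS_jacobi_along V c J' t k.
Proof.
  intros HI HJ HJ' It k.
  destruct (proj2 (lin_derive _ a J J' HI HJ HJ') t It) as [E1 E2].
  unfold gS_jacobi_along; rewrite E1, E2.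
  unfold jacobi_op, lin, sum4; ring.
Qed.

Lemma conformal_jacobi_along_lin V f c a J J' t :
  open_interval (dom c) ->
  (forall k, C2_on (dom c) (fun t => J t k)) ->
  (forall k, C2_on (dom c) (fun t => J' t k)) -> dom c t ->
  forall k, conformal_jacobi_along V f c (lin a J J') t k =
    a * conformal_jacobi_along V f c J t k
    + conformal_jacobi_along V f c J' t k.
Proof.
  intros HI HJ HJ' It k; unfold conformal_jacobi_along.
  rewrite (gS_jacobi_along_lin V c a J J' t HI HJ HJ' It).
  destruct (proj2 (lin_derive _ a J J' HI HJ HJ') t It) as [E1 _].
  rewrite E1; unfold df_dot, gS_inner_dot, gS_inner, df, lin; ring.
Qed.

Lemma zero_jacobi_along V f c t k :
  gS_jacobi_along V c (fun _ _ => 0) t k = 0 /\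
  conformal_jacobi_along V f c (fun _ _ => 0) t k = 0.
Proof.
  unfold conformal_jacobi_along, gS_jacobi_along.
  rewrite !zero_field_velocity.
  unfold jacobi_op, df_dot, gS_inner_dot, gS_inner, df, sum4; split; ring.
Qed.

Lemma derivative_of_zero I (u : R -> R) t (l : R) :
  open_interval I -> (forall t, I t -> u t = 0) -> I t -> is_derive u t l ->
  l = 0.
Proof.
  intros HI Hu It D; rewrite <- (is_derive_unique _ _ _ D).
  transitivity (Derive (fun _ => 0) t); [ | apply Derive_const].
  apply Derive_ext_loc.
  exact (filter_imp _ _ Hu (open_interval_locally I t HI It)).
Qed.

Lemma gS_inner_zero V x y X Y : (forall k, Y k = 0) -> gS_inner V x y X Y = 0.
Proof. intro E; unfold gS_inner; rewrite !E; ring. Qed.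

(** * Jacobi fields vanishing at two points *)

Definition inner_dot_along (V : R -> R -> R) (c : curve vec) (K : R -> vec)
    (t : R) : R :=
  gS_inner_dot V (pt c t cx) (pt c t cy) (velocity (pt c) t) (K t)
    (velocity K t).

Definition df_along (f : R -> R -> R) (c : curve vec) (K : R -> vec) (t : R)
    : R := df f (pt c t cx) (pt c t cy) (K t).

Definition df_dot_along (f : R -> R -> R) (c : curve vec) (K : R -> vec)
    (t : R) : R :=
  df_dot f (pt c t cx) (pt c t cy) (velocity (pt c) t) (K t) (velocity K t).

Definition zero_at (K : R -> vec) (a : R) : Prop := forall k, K a k = 0.

Lemma is_derive_df_along U V f c K t :
  open U -> C2_plane U f -> normal_geodesic U V c ->
  (forall i, C2_on (dom c) (fun s => K s i)) -> dom c t ->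
  is_derive (df_along f c K) t (df_dot_along f c K t).
Proof.
  intros HU Hf Hc HK It; apply (is_derive_df U V); try assumption.
  intro i; exact (C2_on_derive _ _ t (HK i) It).
Qed.

Lemma continuous_df_dot U V f c K t :
  C2_plane U f -> normal_geodesic U V c ->
  (forall i, C2_on (dom c) (fun s => K s i)) -> dom c t ->
  continuous (df_dot_along f c K) t.
Proof.
  intros (Hf & Hfx & Hfy) Hc HK It.
  assert (c1 := fun k => C2_on_continuous1 _ _ t (ng_C2 U V c Hc k) It
    : continuous (fun s => velocity (pt c) s k) t).
  assert (k0 := fun k => C2_on_continuous _ _ t (HK k) It).
  assert (k1 := fun k => C2_on_continuous1 _ _ t (HK k) It
    : continuous (fun s => velocity K s k) t).
  assert (cd := fun h Hh X HX => continuous_df U V h c X t Hh Hc It HX).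
  exact (continuous_plus_R _ _ t (continuous_plus_R _ _ t
      (continuous_mult_R _ _ t (cd _ Hfx _ k0) (c1 cx))
      (continuous_mult_R _ _ t (cd _ Hfy _ k0) (c1 cy))) (cd _ Hf _ k1)).
Qed.

Lemma inner_dot_along_zero U V c K t :
  open U -> C2_plane U V -> normal_geodesic U V c ->
  (forall i, C2_on (dom c) (fun s => K s i)) ->
  (forall t, dom c t -> gS_inner V (pt c t cx) (pt c t cy)
     (velocity (pt c) t) (K t) = 0) ->
  dom c t -> inner_dot_along V c K t = 0.
Proof.
  intros HU HV Hc HK H0 It.
  apply (derivative_of_zero (dom c) (fun t => gS_inner V (pt c t cx) (pt c t cy)
     (velocity (pt c) t) (K t)) t); try assumption; [apply Hc | ].
  apply (is_derive_gS_inner U); try assumption.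
  intro i; exact (C2_on_derive _ _ t (HK i) It).
Qed.

(** The product of [c'] with a Jacobi field is affine, and it has two
    zeros. *)
Lemma gS_jacobi_orthogonal U V c J a a' t :
  open U -> C2_plane U V -> normal_geodesic U V c ->
  (forall i, C2_on (dom c) (fun s => J s i)) ->
  (forall t, dom c t -> forall k, gS_jacobi_along V c J t k = 0) ->
  dom c a -> dom c a' -> a < a' -> zero_at J a -> zero_at J a' ->
  dom c t -> inner_dot_along V c J t = 0.
Proof.
  intros HU HV Hc HJ HL Ia Ia' Haa Ha Ha' It.
  apply (inner_dot_along_zero U V c J t HU HV Hc HJ); [ | exact It].
  intros s Is.
  apply (two_zeros_affine (dom c) (fun t => gS_inner V (pt c t cx) (pt c t cy)
    (velocity (pt c) t) (J t)) (inner_dot_along V c J) a a'); try assumption.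
  - apply Hc.
  - intros r Ir; apply (is_derive_gS_inner U); try assumption.
    intro i; exact (C2_on_derive _ _ r (HJ i) Ir).
  - intros r Ir.
    rewrite <- (gS_inner_zero V (pt c r cx) (pt c r cy) (velocity (pt c) r)
      (gS_jacobi_along V c J r) (HL r Ir)).
    exact (is_derive_gS_inner_dot U V c J r HU HV Hc HJ Ir).
  - apply gS_inner_zero, Ha.
  - apply gS_inner_zero, Ha'.
Qed.

(** For the conformal metric the derivative [u] of this product satisfies
    [u' = 2 W' u], so it is a constant times [exp (2 W)] and cannot change
    sign between the two zeros. *)
Lemma conformal_jacobi_orthogonal U V f c K a a' t :
  open U -> C2_plane U V -> C2_plane U f ->
  normal_geodesic U V c -> null_curve V c ->
  (forall i, C2_on (dom c) (fun s => K s i)) ->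
  (forall t, dom c t -> forall k, conformal_jacobi_along V f c K t k = 0) ->
  dom c a -> dom c a' -> a < a' -> zero_at K a -> zero_at K a' ->
  dom c t -> inner_dot_along V c K t = 0.
Proof.
  intros HU HV Hf Hc Hn HK HL Ia Ia' Haa Ha Ha' It.
  assert (HI := ng_interval U V c Hc).
  apply (inner_dot_along_zero U V c K t HU HV Hc HK); [ | exact It].
  assert (HW : forall t, dom c t ->
      is_derive (log_factor f c) t (log_factor_dot f c t))
    by (intros r Ir; apply (is_derive_comp_normal U V); try assumption;
        apply Hf).
  assert (Hdd : forall r, dom c r ->
      is_derive (inner_dot_along V c K) r
        (2 * log_factor_dot f c r * inner_dot_along V c K r)).
  { intros r Ir; evar_last;
      [exact (is_derive_gS_inner_dot U V c K r HU HV Hc HK Ir) | ].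
    transitivity (gS_inner V (pt c r cx) (pt c r cy) (velocity (pt c) r)
      (fun k => - (2 * df_dot_along f c K r) * velocity (pt c) r k
        + 2 * inner_dot_along V c K r * gS_grad f k (pt c r cx) (pt c r cy))).
    - f_equal; apply functional_extensionality; intro k.
      assert (E := HL r Ir k); unfold conformal_jacobi_along in E.
      unfold df_dot_along, inner_dot_along; lra.
    - transitivity (- (2 * df_dot_along f c K r) *
          gS_inner V (pt c r cx) (pt c r cy) (velocity (pt c) r)
            (velocity (pt c) r)
        + 2 * log_factor_dot f c r * inner_dot_along V c K r).
      + unfold log_factor_dot, df, gS_inner, gS_grad; simpl; ring.
      + rewrite (Hn r Ir); ring. }
  pose (C := exp (- 2 * log_factor f c a) * inner_dot_along V c K a).
  assert (HC : forall r, dom c r ->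
      inner_dot_along V c K r = C * exp (2 * log_factor f c r)).
  { intros r Ir.
    assert (E : exp (- 2 * log_factor f c r) * inner_dot_along V c K r = C).
    { apply (derive_zero_const (dom c)
        (fun r => exp (- 2 * log_factor f c r) * inner_dot_along V c K r));
        try assumption.
      intros s Is; evar_last.
      - apply is_derive_mult_R; [ | exact (Hdd s Is)].
        exact (is_derive_exp_scal (- 2) _ s _ (HW s Is)).
      - cbv beta; ring. }
    rewrite <- E.
    transitivity (exp (- 2 * log_factor f c r + 2 * log_factor f c r)
      * inner_dot_along V c K r); [ | rewrite exp_plus; ring].
    replace (- 2 * log_factor f c r + 2 * log_factor f c r) with 0 by ring.
    rewrite exp_0; ring. }
  intros s Is.
  apply (two_zeros_vanish (dom c) (fun t => gS_inner V (pt c t cx) (pt c t cy)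
    (velocity (pt c) t) (K t)) (fun r => exp (2 * log_factor f c r)) C a a');
    try assumption.
  - intros; apply exp_pos.
  - intros r Ir; rewrite <- (HC r Ir).
    apply (is_derive_gS_inner U); try assumption.
    intro i; exact (C2_on_derive _ _ r (HK i) Ir).
  - apply gS_inner_zero, Ha.
  - apply gS_inner_zero, Ha'.
Qed.

(** A field [phi c'] adds [phi W'] to [df J]. It does not change the product
    with [c'], because [c'] is null. *)
Lemma conformal_jacobi_tangential U V f c J K (phi phi1 phi2 : R -> R) t k :
  open U -> C2_plane U V -> C2_plane U f ->
  normal_geodesic U V c -> null_curve V c ->
  (forall k, C2_on (dom c) (fun t => J t k)) ->
  (forall t, dom c t -> is_derive phi t (phi1 t)) ->
  (forall t, dom c t -> is_derive phi1 t (phi2 t)) ->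
  (forall t, dom c t -> continuous phi2 t) ->
  tangential_change c J K phi -> dom c t ->
  conformal_jacobi_along V f c K t k = conformal_jacobi_along V f c J t k
    + (phi2 t + 2 * (phi1 t * log_factor_dot f c t
         + phi t * df_dot_along f c (velocity (pt c)) t))
      * velocity (pt c) t k.
Proof.
  intros HU HV Hf Hc Hn HJ H0 H1 H2 HK It.
  destruct (tangential_derive U V c J K phi phi1 phi2 HU HV Hc HJ H0 H1 H2 HK)
    as [_ D].
  assert (EK : K t = fun k => J t k + phi t * velocity (pt c) t k)
    by (apply functional_extensionality; exact (HK t It)).
  assert (EV : velocity K t = fun k => velocity J t k
      + (phi1 t * velocity (pt c) t k
         + phi t * velocity (velocity (pt c)) t k))
    by (apply functional_extensionality; intro i; apply (D t It i)).
  assert (N := Hn t It).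
  unfold conformal_jacobi_along; rewrite (proj2 (D t It k)), EK, EV.
  assert (E1 : df_dot f (pt c t cx) (pt c t cy) (velocity (pt c) t)
      (fun k => J t k + phi t * velocity (pt c) t k)
      (fun k => velocity J t k + (phi1 t * velocity (pt c) t k
         + phi t * velocity (velocity (pt c)) t k)) =
    df_dot f (pt c t cx) (pt c t cy) (velocity (pt c) t) (J t) (velocity J t)
      + (phi1 t * log_factor_dot f c t
         + phi t * df_dot_along f c (velocity (pt c)) t)).
  { unfold df_dot_along, log_factor_dot, df_dot, df; ring. }
  assert (E2 : gS_inner_dot V (pt c t cx) (pt c t cy) (velocity (pt c) t)
      (fun k => J t k + phi t * velocity (pt c) t k)
      (fun k => velocity J t k + (phi1 t * velocity (pt c) t k
         + phi t * velocity (velocity (pt c)) t k)) =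
    gS_inner_dot V (pt c t cx) (pt c t cy) (velocity (pt c) t) (J t)
      (velocity J t)).
  { assert (Z : inner_dot_along V c (velocity (pt c)) t = 0)
      by (apply (inner_dot_along_zero U); try assumption;
          intro i; apply (normal_velocity_C2 U V); assumption).
    unfold inner_dot_along in Z.
    transitivity (gS_inner_dot V (pt c t cx) (pt c t cy) (velocity (pt c) t)
        (J t) (velocity J t)
      + phi1 t * gS_inner V (pt c t cx) (pt c t cy) (velocity (pt c) t)
          (velocity (pt c) t)
      + phi t * gS_inner_dot V (pt c t cx) (pt c t cy) (velocity (pt c) t)
          (velocity (pt c) t) (velocity (velocity (pt c)) t)).
    - unfold gS_inner_dot, gS_inner, df; ring.
    - rewrite N, Z; ring. }
  rewrite E1, E2; ring.
Qed.

Definition gS_field (V : R -> R -> R) (c : curve vec) (a a' : R)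
    (J : R -> vec) : Prop :=
  (forall k, C2_on (dom c) (fun t => J t k)) /\
  (forall t, dom c t -> forall k, gS_jacobi_along V c J t k = 0) /\
  zero_at J a /\ zero_at J a'.

Definition conformal_field (V f : R -> R -> R) (c : curve vec) (a a' : R)
    (K : R -> vec) : Prop :=
  (forall k, C2_on (dom c) (fun t => K t k)) /\
  (forall t, dom c t -> forall k, conformal_jacobi_along V f c K t k = 0) /\
  zero_at K a /\ zero_at K a'.

(** With [J] orthogonal to [c'], the field [J + phi c'] satisfies the conformal
    equation as soon as [phi'' + 2 (df J + phi W')' = 0], that is
    [phi' + 2 W' phi + 2 df J = C]. The integrating factor [exp (2 W)] solves
    this, and [C] is chosen to make [phi] vanish at both ends. *)
Lemma gS_field_to_conformal U V f c a a' J :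
  open U -> C2_plane U V -> C2_plane U f ->
  normal_geodesic U V c -> null_curve V c ->
  dom c a -> dom c a' -> a < a' -> gS_field V c a a' J ->
  exists phi, forall K, tangential_change c J K phi ->
    conformal_field V f c a a' K.
Proof.
  intros HU HV Hf Hc Hn Ia Ia' Haa (HJ & HL & Ha & Ha').
  assert (HI := ng_interval U V c Hc).
  assert (Hv : forall i, C2_on (dom c) (fun t => velocity (pt c) t i))
    by (intro i; apply (normal_velocity_C2 U V); assumption).
  assert (DW : forall t, dom c t ->
      is_derive (log_factor f c) t (log_factor_dot f c t))
    by (intros r Ir; apply (is_derive_comp_normal U V); try assumption;
        apply Hf).
  assert (DW1 : forall t, dom c t -> is_derive (log_factor_dot f c) t
      (df_dot_along f c (velocity (pt c)) t))
    by (intros t It; exact (is_derive_df_along U V f c _ t HU Hf Hc Hv It)).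
  assert (DJ := fun t It => is_derive_df_along U V f c J t HU Hf Hc HJ It).
  pose (m := fun t => exp (2 * log_factor f c t)).
  assert (Dm : forall t, dom c t ->
      is_derive m t (2 * log_factor_dot f c t * m t))
    by (intros t It; exact (is_derive_exp_scal 2 _ t _ (DW t It))).
  assert (Cm : forall t, dom c t -> continuous m t)
    by (intros t It; exact (is_derive_continuous _ t _ (Dm t It))).
  destruct (two_point_primitive (dom c)
    (fun t => m t * (- 2 * df_along f c J t)) m a a' HI Ia Ia' Haa)
    as (C & u & Du & ua & ua').
  { intros t It; apply continuous_mult_R; [exact (Cm t It) | ].
    exact (is_derive_continuous _ t _
      (is_derive_scal_R (- 2) _ t _ (DJ t It))). }
  { exact Cm. }
  { intros; apply exp_pos. }
  pose (q := fun t => exp (- 2 * log_factor f c t)).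
  assert (qm : forall t, q t * m t = 1).
  { intro t; unfold q, m; rewrite <- exp_plus.
    replace (_ + _) with 0 by ring; apply exp_0. }
  pose (phi := fun t => q t * u t).
  pose (phi1 := fun t => - 2 * (log_factor_dot f c t * phi t)
    + (- 2 * df_along f c J t + C)).
  pose (phi2 := fun t => - 2 * (df_dot_along f c (velocity (pt c)) t * phi t
    + log_factor_dot f c t * phi1 t) + - 2 * df_dot_along f c J t).
  assert (Dphi : forall t, dom c t -> is_derive phi t (phi1 t)).
  { intros t It; evar_last.
    - apply is_derive_mult_R; [ | exact (Du t It)].
      exact (is_derive_exp_scal (- 2) _ t _ (DW t It)).
    - cbv beta; unfold phi1, phi; fold (q t).
      transitivity (- 2 * log_factor_dot f c t * q t * u t
        + q t * m t * (- 2 * df_along f c J t + C)); [ring | ].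
      rewrite qm; ring. }
  assert (Dphi1 : forall t, dom c t -> is_derive phi1 t (phi2 t)).
  { intros t It; evar_last.
    - apply is_derive_plus_R.
      + apply is_derive_scal_R, is_derive_mult_R;
          [exact (DW1 t It) | exact (Dphi t It)].
      + apply is_derive_plus_R;
          [exact (is_derive_scal_R (- 2) _ t _ (DJ t It)) | ].
        exact (is_derive_const C t).
    - unfold phi2, zero; simpl; ring. }
  assert (Cphi2 : forall t, dom c t -> continuous phi2 t).
  { intros t It.
    assert (c0 := is_derive_continuous _ t _ (Dphi t It)).
    assert (c1 := is_derive_continuous _ t _ (Dphi1 t It)).
    assert (cW := is_derive_continuous _ t _ (DW1 t It)).
    assert (cW2 := continuous_df_dot U V f c _ t Hf Hc Hv It).
    assert (cJ := continuous_df_dot U V f c _ t Hf Hc HJ It).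
    assert (k2 := continuous_const (- 2) t : continuous (fun _ : R => - 2) t).
    exact (continuous_plus_R _ _ t
      (continuous_mult_R _ _ t k2 (continuous_plus_R _ _ t
        (continuous_mult_R _ _ t cW2 c0) (continuous_mult_R _ _ t cW c1)))
      (continuous_mult_R _ _ t k2 cJ)). }
  exists phi; intros K HK.
  destruct (tangential_derive U V c J K phi phi1 phi2 HU HV Hc HJ
    Dphi Dphi1 Cphi2 HK) as [CK _].
  split; [exact CK | split; [ | split]].
  - intros t It k.
    rewrite (conformal_jacobi_tangential U V f c J K phi phi1 phi2 t k)
      by assumption.
    assert (Z := gS_jacobi_orthogonal U V c J a a' t HU HV Hc HJ HL
      Ia Ia' Haa Ha Ha' It).
    unfold inner_dot_along in Z; unfold conformal_jacobi_along.
    rewrite (HL t It k), Z.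
    unfold phi2, df_dot_along; ring.
  - intro k; rewrite (HK a Ia k), (Ha k); unfold phi; rewrite ua; ring.
  - intro k; rewrite (HK a' Ia' k), (Ha' k); unfold phi; rewrite ua'; ring.
Qed.

(** In this direction the multiple [psi] has to satisfy [psi'' = 2 (df K)'],
    and the integration constant again provides the second zero. *)
Lemma conformal_field_to_gS U V f c a a' K :
  open U -> C2_plane U V -> C2_plane U f ->
  normal_geodesic U V c -> null_curve V c ->
  dom c a -> dom c a' -> a < a' -> conformal_field V f c a a' K ->
  exists psi, forall J, tangential_change c K J psi -> gS_field V c a a' J.
Proof.
  intros HU HV Hf Hc Hn Ia Ia' Haa (HK & HL & Ha & Ha').
  assert (HI := ng_interval U V c Hc).
  assert (DK := fun t It => is_derive_df_along U V f c K t HU Hf Hc HK It).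
  destruct (two_point_primitive (dom c) (fun t => 2 * df_along f c K t)
    (fun _ => 1) a a' HI Ia Ia' Haa) as (C & psi & Dpsi & pa & pa').
  { intros t It.
    exact (is_derive_continuous _ t _ (is_derive_scal_R 2 _ t _ (DK t It))). }
  { intros; apply continuous_const. }
  { intros; lra. }
  assert (Dpsi1 : forall t, dom c t ->
      is_derive (fun t => 2 * df_along f c K t + C * 1) t
        (2 * df_dot_along f c K t)).
  { intros t It; evar_last.
    - apply is_derive_plus_R; [exact (is_derive_scal_R 2 _ t _ (DK t It)) | ].
      exact (is_derive_const (C * 1) t).
    - unfold zero; simpl; ring. }
  exists psi; intros J HJ.
  destruct (tangential_derive U V c K J psi _ _ HU HV Hc HK Dpsi Dpsi1)
    as [CJ D]; [ | exact HJ | ].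
  { intros t It.
    apply (continuous_mult_R (fun _ => 2)); [apply continuous_const | ].
    exact (continuous_df_dot U V f c K t Hf Hc HK It). }
  split; [exact CJ | split; [ | split]].
  - intros t It k; rewrite (proj2 (D t It k)).
    assert (E := HL t It k).
    assert (Z := conformal_jacobi_orthogonal U V f c K a a' t HU HV Hf Hc Hn
      HK HL Ia Ia' Haa Ha Ha' It).
    unfold inner_dot_along in Z; unfold conformal_jacobi_along in E.
    rewrite Z in E.
    unfold df_dot_along; lra.
  - intro k; rewrite (HJ a Ia k), (Ha k), pa; ring.
  - intro k; rewrite (HJ a' Ia' k), (Ha' k), pa'; ring.
Qed.

(** A tangential Jacobi field is [(alpha t + beta) c'], by its component
    along the coordinate [t]. *)
Lemma tangential_gS_field_zero U V c a a' J (phi : R -> R) t k :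
  normal_geodesic U V c -> dom c a -> dom c a' -> a < a' ->
  gS_field V c a a' J ->
  (forall t, dom c t -> forall k, J t k = phi t * velocity (pt c) t k) ->
  dom c t -> J t k = 0.
Proof.
  intros Hc Ia Ia' Haa (HJ & HL & Ha & Ha') E It.
  assert (Z : forall t, dom c t -> J t ct = 0).
  { intros s Is.
    apply (two_zeros_affine (dom c) (fun t => J t ct)
      (fun t => velocity J t ct) a a'); try assumption.
    - apply Hc.
    - intros r Ir; exact (C2_on_derive _ _ r (HJ ct) Ir).
    - intros r Ir; assert (L := HL r Ir ct); unfold gS_jacobi_along in L.
      rewrite (proj1 (proj2 (gS_jacobi_op V _ _ _ (J r) (velocity J r)
        (velocity (velocity J) r) (ng_t1 U V c Hc r Ir)))) in L.
      rewrite <- L; exact (C2_on_derive2 _ _ r (HJ ct) Ir).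
    - apply Ha.
    - apply Ha'. }
  assert (P := Z t It); rewrite (E t It), (ng_t1 U V c Hc t It) in P.
  rewrite (E t It); replace (phi t) with 0 by lra; ring.
Qed.

(** Here the component along [t] gives [phi' + 2 W' phi = C]. *)
Lemma tangential_conformal_field_zero U V f c a a' K (phi : R -> R) t k :
  open U -> C2_plane U f -> normal_geodesic U V c ->
  dom c a -> dom c a' -> a < a' -> conformal_field V f c a a' K ->
  (forall t, dom c t -> forall k, K t k = phi t * velocity (pt c) t k) ->
  dom c t -> K t k = 0.
Proof.
  intros HU Hf Hc Ia Ia' Haa (HK & HL & Ha & Ha') E It.
  assert (HI := ng_interval U V c Hc).
  assert (Ephi : forall t, dom c t -> K t ct = phi t)
    by (intros s Is; rewrite (E s Is), (ng_t1 U V c Hc s Is); ring).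
  pose (w := fun t => velocity K t ct + 2 * df_along f c K t).
  assert (Dw : forall t, dom c t -> is_derive w t 0).
  { intros s Is; assert (L := HL s Is ct); unfold conformal_jacobi_along in L.
    unfold gS_jacobi_along in L.
    rewrite (proj1 (proj2 (gS_jacobi_op V _ _ _ (K s) (velocity K s)
      (velocity (velocity K) s) (ng_t1 U V c Hc s Is)))) in L.
    rewrite (ng_t1 U V c Hc s Is) in L; simpl in L.
    evar_last.
    - apply is_derive_plus_R.
      + exact (C2_on_derive2 _ _ s (HK ct) Is).
      + apply is_derive_scal_R.
        exact (is_derive_df_along U V f c K s HU Hf Hc HK Is).
    - change (velocity (velocity K) s ct + 2 * df_dot_along f c K s = 0).
      unfold df_dot_along; lra. }
  assert (Z : forall t, dom c t ->
      exp (2 * log_factor f c t) * K t ct = 0).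
  { intros s Is.
    apply (two_zeros_vanish (dom c)
      (fun t => exp (2 * log_factor f c t) * K t ct)
      (fun t => exp (2 * log_factor f c t)) (w a) a a'); try assumption.
    - intros; apply exp_pos.
    - intros r Ir; evar_last.
      + apply is_derive_mult_R; [ | exact (C2_on_derive _ _ r (HK ct) Ir)].
        apply (is_derive_exp_scal 2 (log_factor f c) r (log_factor_dot f c r)).
        apply (is_derive_comp_normal U V); try assumption; apply Hf.
      + rewrite (derive_zero_const (dom c) w a r HI Dw Ia Ir).
        unfold w, df_along, df; rewrite !(E r Ir cx), !(E r Ir cy), (Ephi r Ir).
        change (Derive (fun t => K t ct) r) with (velocity K r ct).
        unfold log_factor_dot, df; ring.
    - rewrite (Ha ct); ring.
    - rewrite (Ha' ct); ring. }
  assert (P := Z t It); rewrite (Ephi t It) in P.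
  apply Rmult_integral in P; destruct P as [P | P].
  - assert (Q := exp_pos (2 * log_factor f c t)); lra.
  - rewrite (E t It), P; ring.
Qed.

(** * Conformal invariance of conjugate points *)

Lemma jacobi_vanishing_gS U V c a a' J :
  open U -> C2_plane U V -> geodesic (gS U V) c ->
  jacobi_vanishing (gS U V) c a a' J <-> gS_field V c a a' J.
Proof.
  intros HU HV Hc; unfold jacobi_vanishing, gS_field.
  rewrite (gS_jacobi_iff U V c J HU HV Hc); unfold zero_at; tauto.
Qed.

Lemma jacobi_vanishing_conformal U V f c tau sigma a a' X :
  open U -> C2_plane U V -> C2_plane U f ->
  normal_geodesic U V c -> null_curve V c -> conformal_time f c tau sigma ->
  jacobi_vanishing (conformal_gS U V f) (reparam c tau sigma) (tau a) (tau a') X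
  <-> conformal_field V f c a a' (fun t => X (tau t)).
Proof.
  intros HU HV Hf Hc Hn Htc; unfold jacobi_vanishing, conformal_field.
  rewrite (conformal_jacobi_iff U V f c tau sigma X HU HV Hf Hc Hn Htc).
  unfold zero_at; tauto.
Qed.

(** At corresponding parameters the two fields agree modulo the velocity. *)
Definition jacobi_related (V f : R -> R -> R) (c : curve vec) (tau : R -> R)
    (a a' : R) (J X : R -> vec) : Prop :=
  gS_field V c a a' J /\ conformal_field V f c a a' (fun t => X (tau t)) /\
  exists phi, tangential_change c J (fun t => X (tau t)) phi.

Theorem jacobi_correspondence U V f c tau sigma a a' :
  open U -> C2_plane U V -> C2_plane U f -> geodesic (gS U V) c ->
  normal_geodesic U V c -> null_curve V c -> conformal_time f c tau sigma ->
  dom c a -> dom c a' -> a < a' ->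
  correspondence (jacobi_vanishing (gS U V) c a a')
    (jacobi_vanishing (conformal_gS U V f) (reparam c tau sigma)
       (tau a) (tau a'))
    (dom c) (dom (reparam c tau sigma)) (jacobi_related V f c tau a a').
Proof.
  intros HU HV Hf Hg Hc Hn Htc Ia Ia' Haa.
  assert (HI := ng_interval U V c Hc).
  assert (HP := fun J => jacobi_vanishing_gS U V c a a' J HU HV Hg).
  assert (HQ := fun X => jacobi_vanishing_conformal U V f c tau sigma a a' X
    HU HV Hf Hc Hn Htc).
  split.
  - intros J X (HJ & _); apply HP, HJ.
  - intros J X (_ & HX & _); apply HQ, HX.
  - assert (C0 : forall k : coord, C2_on (dom c) (fun _ => 0))
      by (intros _; apply C2_on_const, HI).
    split; [ | split].
    + split; [exact C0 | split; [ | split; intro; reflexivity]].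
      intros t _ k; apply (zero_jacobi_along V f c t k).
    + split; [exact C0 | split; [ | split; intro; reflexivity]].
      intros t _ k; apply (zero_jacobi_along V f c t k).
    + exists (fun _ => 0); intros t _ k; ring.
  - intros r J J' X X' (HJ & HX & phi & E) (HJ' & HX' & phi' & E').
    split; [ | split].
    + destruct HJ as (C & L & Z & Z'); destruct HJ' as (C' & L' & W & W').
      split; [apply (lin_derive (dom c)); assumption | ].
      split; [ | split; intro k; unfold lin; rewrite ?Z, ?Z', ?W, ?W'; ring].
      intros t It k; rewrite gS_jacobi_along_lin by assumption.
      rewrite L, L' by assumption; ring.
    + destruct HX as (C & L & Z & Z'); destruct HX' as (C' & L' & W & W').
      change (conformal_field V f c a a'
        (lin r (fun t => X (tau t)) (fun t => X' (tau t)))).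
      split; [apply (lin_derive (dom c)); assumption | ].
      split; [ | split; intro k; unfold lin; rewrite ?Z, ?Z', ?W, ?W'; ring].
      intros t It k; rewrite conformal_jacobi_along_lin by assumption.
      rewrite L, L' by assumption; ring.
    + exists (fun t => r * phi t + phi' t); intros t It k; unfold lin.
      rewrite (E t It k), (E' t It k); ring.
  - intros J HJ; apply HP in HJ.
    destruct (gS_field_to_conformal U V f c a a' J HU HV Hf Hc Hn Ia Ia' Haa HJ)
      as [phi Hphi].
    pose (X := fun s k => J (sigma s) k
      + phi (sigma s) * velocity (pt c) (sigma s) k).
    assert (HX : tangential_change c J (fun t => X (tau t)) phi)
      by (intros t It k; unfold X; rewrite (tc_inverse _ _ _ _ _ Htc t It);
          reflexivity).
    exists X; split; [exact HJ | split; [exact (Hphi _ HX) | ]].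
    exists phi; exact HX.
  - intros X HX; apply HQ in HX.
    destruct (conformal_field_to_gS U V f c a a' _ HU HV Hf Hc Hn Ia Ia' Haa HX)
      as [psi Hpsi].
    exists (fun t k => X (tau t) k + psi t * velocity (pt c) t k).
    split; [apply Hpsi; intros t It k; reflexivity | split; [exact HX | ]].
    exists (fun t => - psi t); intros t It k; ring.
  - intros J X (HJ & HX & phi & E) Z s k (t & It & <-).
    apply (tangential_conformal_field_zero U V f c a a' (fun t => X (tau t)) phi
      t k); try assumption.
    intros r Ir i; rewrite (E r Ir i), (Z r i Ir); ring.
  - intros J X (HJ & HX & phi & E) Z t k It.
    apply (tangential_gS_field_zero U V c a a' J (fun t => - phi t) t k);
      try assumption.
    intros r Ir i; assert (P := E r Ir i); cbv beta in P.
    rewrite (Z (tau r) i) in P by (exists r; auto); lra.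
Qed.

Theorem theorem4
    (U : R * R -> Prop) (V : R -> R -> R)
    (U_open : open U) (U_connected : connected U)
    (V_harmonic : harmonic U V) (t0 : R) :
  (* (1) *)
  (forall z0 dz0 : C, U z0 ->
     exists Phi : curve C -> curve vec,
       bijection
         (fun z => maximal (solution U V) z /\ initial_z t0 z0 dz0 z)
         (fun c => maximal (geodesic (gS U V)) c /\
                   lightlike_geodesic (gS U V) c /\
                   initial_geodesic V t0 z0 dz0 c)
         Phi /\
       forall z, maximal (solution U V) z -> initial_z t0 z0 dz0 z ->
         same_components z (Phi z)) /\
  (* (2) and (3) *)
  (forall f : R -> R -> R, C2_plane U f ->
   forall (z0 dz0 : C) (z : curve C) (c : curve vec),
     solution U V z -> initial_z t0 z0 dz0 z ->
     lightlike_geodesic (gS U V) c -> initial_geodesic V t0 z0 dz0 c ->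
     same_components z c ->
     let tau := conf_time (on_R4 f) (pt c) t0 in
     let gf := conformal (on_R4 f) (gS U V) in
     exists sigma : R -> R,
       (forall t, dom c t -> sigma (tau t) = t) /\
       let cf := Curve (fun s => exists t, dom c t /\ tau t = s)
                       (fun s => pt c (sigma s)) in
       lightlike_geodesic gf cf /\
       forall a a', dom c a -> dom c a' -> a < a' ->
         (conjugate (gS U V) c a a' <-> conjugate gf cf (tau a) (tau a')) /\
         forall n : nat, multiplicity (gS U V) c a a' n <->
                         multiplicity gf cf (tau a) (tau a') n).
Proof.
  destruct V_harmonic as [HV _]; split.
  - intros z0 dz0 _; exists (lift V t0).
    apply (null_geodesics_bijection U); assumption.
  - intros f Hf z0 dz0 z c _ _ [Hg Hl] Hi _ tau gf.
    assert (Hc := initial_normal U V t0 z0 dz0 c U_open HV Hg Hi).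
    assert (Hn : null_curve V c)
      by (intros t It; rewrite <- (inner_gS U); apply (Hl t It)).
    destruct (conf_time_change U V f c t0 U_open Hf Hc (proj1 Hi))
      as [sigma Htc]; fold tau in Htc.
    exists sigma; split; [exact (tc_inverse _ _ _ _ _ Htc) | intro cf].
    split.
    { exact (reparam_null_geodesic U V f c tau sigma U_open HV Hf Hc Hn Htc). }
    intros a a' Ia Ia' Haa.
    assert (HR := jacobi_correspondence U V f c tau sigma a a' U_open HV Hf Hg
      Hc Hn Htc Ia Ia' Haa).
    assert (HL := correspondence_sym _ _ _ _ _ HR).
    split.
    + split; intros (_ & _ & _ & H).
      * split; [exists a; auto | split; [exists a'; auto | split]].
        -- apply (positive_derive_increasing (dom c) tau _ a a'
             (ng_interval U V c Hc) (tc_tau _ _ _ _ _ Htc)); try assumption.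
           intros; apply exp_pos.
        -- exact (correspondence_nontrivial _ _ _ _ _ HR H).
      * split; [exact Ia | split; [exact Ia' | split; [exact Haa | ]]].
        exact (correspondence_nontrivial _ _ _ _ _ HL H).
    + intro n; split; intro H.
      * exact (correspondence_basis _ _ _ _ _ n HR H).
      * exact (correspondence_basis _ _ _ _ _ n HL H).
Qed.
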